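(* Let $n_0,d\in\mathbb{N}$, and let $f\colon[n_0,\infty)\to\mathbb{R}$ be a differentiable function in $\mathcal{H}$ satisfying that (a1) $x^d\log x\prec f(x)\prec x^{d+1}$ as $x\to\infty$; (a2) $\inf_{x\ge n_0}f'(x)\ge1$. Then, for all integers $k\ge d+2$ and $r\ge1$, $$\lim_{N\to\infty}\frac1N\#\{n\in[n_0,N]\cap\mathbb{Z} : (\lfloor f(n+rj)\rfloor)_{j=0}^{k-1}\in\mathcal{P}_{k,d}\}=\mu(\mathcal{C}_{k,d+1}),$$ where $\mu$ denotes the Lebesgue measure on $\mathbb{R}^{d+1}$ and the convex set $\mathcal{C}_{k,d+1}\subset\mathbb{R}^{d+1}$ is $$\mathcal{C}_{k,d+1}=\Bigl\{(y_i)_{i=0}^d\in\mathbb{R}^{d+1} : 0\le y_0<1,\ 0\le\sum_{i=0}^d\binom{j}{i}y_i<1\ \text{ for all integers } 1\le j<k\Bigr\}.$$ Also, $\mu(\mathcal{C}_{k,d+1})\ge1/\prod_{i=1}^d\binom{k-1}{i}$.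
   Context: $\mathbb{N}=\{1,2,\ldots\}$; $\lfloor x\rfloor$ is the greatest integer $\le x$. For (eventually) positive functions, $g_1(x)\prec g_2(x)$ means $g_2(x)/g_1(x)\to+\infty$ as $x\to\infty$. Hardy fields: let $\mathcal{B}$ be the ring (under pointwise addition and multiplication) of real-valued functions defined on intervals $[x_0,\infty)$ ($x_0$ depending on the function), where two functions are identified if they agree for all sufficiently large $x$. A Hardy field is a subfield of the ring $\mathcal{B}$ closed under differentiation. $\mathcal{H}$ denotes the union of all Hardy fields. For integers $d\ge1$ and $k\ge d+2$, $\mathcal{P}_{k,d}$ is the set of all strictly increasing sequences $(a(n))_{n=0}^{k-1}$ of elements of $\mathbb{N}$ such that $(\Delta_1^d a(n))_{n=0}^{k-d-1}$ is a constant sequence, where $\Delta_1 a(n)=a(n+1)-a(n)$ and $\Delta_1^m=\Delta_1\circ\Delta_1^{m-1}$ for $m\ge2$. Equivalently, $a(n)=p(n)$ for $0\le n<k$ for some polynomial $p\in\mathbb{Q}[x]$ of degree at most $d$. The binomial coefficient $\binom{n}{l}$ is $0$ if $0\le n<l$. *)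

(* Defs.v *)
From HB Require Import structures.
From mathcomp Require Import all_boot all_order all_algebra.
From mathcomp Require Import all_classical all_reals all_analysis.

Set Implicit Arguments.
Unset Strict Implicit.
Unset Printing Implicit Defensive.

Import Order.TTheory GRing.Theory Num.Theory.
Import numFieldNormedType.Exports.

Local Open Scope classical_set_scope.
Local Open Scope ring_scope.

Definition asymp_lt (R : realType) (g1 g2 : R -> R) : Prop :=
  g2 x / g1 x @[x --> +oo] --> +oo.

(* The ring of germs at +oo is represented by total functions modulo eventual
   equality: a set of germs is a set of functions that is saturated for that
   equivalence.  The junk values of derive1 f do not matter, since the derivative
   is required to exist near +oo. *)
Record hardy_field (R : realType) (H : set (R -> R)) : Prop := HardyField {
  hardy_germ : forall f g : R -> R,
    H f -> (\forall x \near +oo, f x = g x) -> H g ;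
  hardy_one : H (fun=> 1) ;
  hardy_sub : forall f g, H f -> H g -> H (fun x => f x - g x) ;
  hardy_mul : forall f g, H f -> H g -> H (fun x => f x * g x) ;
  hardy_inv : forall f, H f -> ~ (\forall x \near +oo, f x = 0) ->
    exists2 g, H g & \forall x \near +oo, f x * g x = 1 ;
  hardy_derivable : forall f, H f -> \forall x \near +oo, derivable f x 1 ;
  hardy_derive : forall f, H f -> H (derive1 f) }.

Definition in_some_hardy_field (R : realType) (f : R -> R) : Prop :=
  exists2 H, hardy_field H & H f.

(* l is the derivative at x of the restriction of f to D; it is one-sided when
   x is an endpoint of the interval D. *)
Definition is_derive_within (R : realType) (D : set R) (f : R -> R) (x l : R)
    : Prop :=
  (f y - f x) / (y - x) @[y --> within D x^'] --> l.

Definition fdiff (a : nat -> int) : nat -> int := fun n => a n.+1 - a n.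

(* The sequence (a(n)) for 0 <= n < k is represented by a : nat -> int; only
   its values at n < k are used. *)
Definition Pkd (k d : nat) (a : nat -> int) : bool :=
  [&& [forall n : 'I_k, 0 < a n],
      [forall m : 'I_k, forall n : 'I_k, (m < n)%N ==> (a m < a n)] &
      [forall m : 'I_(k - d), forall n : 'I_(k - d),
         iter d fdiff a m == iter d fdiff a n]].

(* The region in dimension d + 1; the second index is d, not the dimension. *)
Definition Ckd (R : realType) (k d : nat) : set (d.+1.-tuple R) :=
  [set y | 0 <= tnth y ord0 < 1 /\
     forall j : nat, (1 <= j < k)%N ->
       0 <= \sum_(i < d.+1) 'C(j, i)%:R * tnth y i < 1].

Definition tcons (T : Type) (n : nat) (p : T * n.-tuple T) : n.+1.-tuple T :=
  [tuple of p.1 :: p.2].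

Fixpoint lebesgue_tuple (R : realType) (n : nat) :
    set (n.-tuple (measurableTypeR R)) -> \bar R :=
  match n with
  | 0 => \d_[tuple]
  | n'.+1 =>
      pushforward (@lebesgue_measure R \x @lebesgue_tuple R n')%E
        (@tcons (measurableTypeR R) n')
  end.

(* lebesgue_tuple is the sigma-finite Borel measure on R^n that gives a product
   of measurable sets the product of their Lebesgue measures. *)
Section lebesgue_tuple_measure.
Variable R : realType.
Local Notation T := (measurableTypeR R).

Lemma measurable_tcons n : measurable_fun [set: T * n.-tuple T] (@tcons T n).
Proof. exact: (measurable_cons measurable_fst measurable_snd). Qed.

Definition box n (A : 'I_n -> set T) : set (n.-tuple T) :=
  [set t | forall i, A i (tnth t i)].

Lemma measurable_box n (A : 'I_n -> set T) :
  (forall i, measurable (A i)) -> measurable (box A).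
Proof.
move=> mA; have -> : box A = \bigcap_(i in [set: 'I_n]) ((@tnth n T ^~ i) @^-1` A i).
  by apply/seteqP; split => t /= h i => [_|]; exact: h.
apply: fin_bigcap_measurable; first exact: finite_finset.
by move=> i _; rewrite -[X in measurable X]setTI; exact: measurable_tnth.
Qed.

Lemma tcons_box n (A : 'I_n.+1 -> set T) :
  @tcons T n @^-1` box A = A ord0 `*` box (fun i => A (lift ord0 i)).
Proof.
apply/seteqP; split => -[x t] /=.
  move=> h; split=> /=; first by have := h ord0; rewrite tnth0.
  by move=> i; have := h (lift ord0 i); rewrite tnthS.
move=> [h0 h] i; case: (unliftP ord0 i) => [j|] ->; last by rewrite tnth0.
by rewrite tnthS; exact: h.
Qed.

Section successor.
Variables (n : nat) (m : {sigma_finite_measure set (n.-tuple T) -> \bar R}).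

Definition lebesgue_cons := pushforward (@lebesgue_measure R \x m)%E (@tcons T n).

Let mp (A : set (n.+1.-tuple T)) : measurable A -> measurable (@tcons T n @^-1` A).
Proof.
by move=> mA; rewrite -[X in measurable X]setTI; exact: measurable_tcons.
Qed.

Let p0 : (lebesgue_cons set0 = 0)%E.
Proof. by rewrite /lebesgue_cons /pushforward preimage_set0 measure0. Qed.

Let p_ge0 A : (0 <= lebesgue_cons A)%E.
Proof. by rewrite /lebesgue_cons /pushforward; apply: measure_ge0. Qed.

Let p_sigma_additive : semi_sigma_additive lebesgue_cons.
Proof.
move=> F mF tF mUF; rewrite /lebesgue_cons /pushforward preimage_bigcup.
apply: measure_semi_sigma_additive.
- by move=> i; exact: mp.
- apply/trivIsetP => /= i j _ _ ij; rewrite -preimage_setI.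
  by move/trivIsetP : tF => /(_ _ _ _ _ ij) ->//; rewrite preimage_set0.
- by rewrite -preimage_bigcup; exact: mp.
Qed.

HB.instance Definition _ := isMeasure.Build _ _ _ lebesgue_cons p0 p_ge0 p_sigma_additive.

Let uncons (t : n.+1.-tuple T) : T * n.-tuple T :=
  (tnth t ord0, [tuple of behead t]).

Let unconsK q : uncons (tcons q) = q.
Proof.
by case: q => x t; rewrite /uncons tnth0; congr pair; exact/val_inj.
Qed.

Let p_sigma_finite : sigma_finite setT lebesgue_cons.
Proof.
have /sigma_finiteP[F [TF ndF Foo]] := sigma_finiteT (@lebesgue_measure R).
have /sigma_finiteP[G [TG ndG Goo]] := sigma_finiteT m.
exists (fun i => uncons @^-1` (F i `*` G i)).
  apply/esym/seteqP; split => // t _.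
  have : setT (uncons t).1 by [].
  have : setT (uncons t).2 by [].
  rewrite TF TG => -[k _ Gk] [l _ Fl]; exists (maxn k l) => //; split.
  - by move: Fl; exact/subsetPset/ndF/leq_maxr.
  - by move: Gk; exact/subsetPset/ndG/leq_maxl.
move=> i; have [mF Fioo] := Foo i; have [mG Gioo] := Goo i; split.
  rewrite -[X in measurable X]setTI.
  apply: (measurable_fun_pair (measurable_tnth ord0) (@measurable_behead _ T n)) => //.
  exact: measurableX.
rewrite /lebesgue_cons /pushforward -comp_preimage.
rewrite (_ : uncons \o @tcons T n = idfun); last by apply/funext => q; exact: unconsK.
by rewrite product_measure1E// lte_mul_pinfty// ge0_fin_numE.
Qed.

HB.instance Definition _ :=
  Measure_isSigmaFinite.Build _ _ _ lebesgue_cons p_sigma_finite.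

End successor.

Lemma lebesgue_tuple_spec n :
  exists2 m : {sigma_finite_measure set (n.-tuple T) -> \bar R},
    (m : set _ -> _) = @lebesgue_tuple R n &
    forall A : 'I_n -> set T, (forall i, measurable (A i)) ->
      m (box A) = (\prod_(i < n) lebesgue_measure (A i))%E.
Proof.
elim: n => [|n [m mE mbox]].
  exists (\d_([tuple] : 0.-tuple T) : {measure set _ -> \bar R}) => // A _.
  by rewrite big_ord0 /= /dirac indicE mem_set// => -[].
exists (lebesgue_cons m); first by rewrite /lebesgue_cons /= -mE.
move=> A mA; rewrite big_ord_recl -mbox//.
rewrite -product_measure1E//; last exact: measurable_box.
by rewrite /= /lebesgue_cons /pushforward tcons_box.
Qed.

End lebesgue_tuple_measure.

(* Main.v *)
Require Import Defs.
From mathcomp Require Import all_boot all_order all_algebra.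
From mathcomp Require Import all_classical all_reals all_analysis.
From mathcomp Require Import measurable_realfun.
From mathcomp Require Import ring lra zify.
Import Order.TTheory GRing.Theory Num.Theory.
Import numFieldNormedType.Exports.
Local Open Scope classical_set_scope.
Local Open Scope ring_scope.

(** Let r be the step and E the shift by r.  Since f grows slower than x^(d+1) and
    belongs to a Hardy field, its derivative u of order d + 1 tends to 0, so that, as
    a function of j < k, f (n + r j) is up to o(1) the polynomial of degree at most d
    that extrapolates the values at j = 0, ..., d.  Extrapolation at integers has
    integer coefficients.  So, for large n, the floors of the f (n + r j) lie on a
    polynomial of degree at most d exactly when the fractional parts of
    f n, ..., f (n + r d), extrapolated in the same way, stay in [0, 1[ up to an error
    o(1) for all j < k ([floor_extrapP]).  In the coordinates given by the iterated
    differences this is the condition that defines the polytope Ckd, and the theorem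
    expresses the equidistribution modulo 1 of the vectors (f n, ..., f (n + r d)).

    The exponential sums.  An integer combination of these d + 1 values is P(E) f for
    a polynomial P of degree at most d.  Van der Corput's inequality replaces P by
    (X^m - 1) P, which raises by one the order of vanishing at 1.  When this order
    reaches d, the combination is a nonzero multiple, up to o(1), of the d-th
    difference g of f, and Fejer's theorem applies: the increments of g decrease to 0,
    and n times the increment tends to infinity ([polynomial_equidistribution]).

    The input from Hardy fields is that u decreases to 0 and x u(x) tends to infinity.
    All of it comes from one principle: an element of a Hardy field has eventually a
    constant sign.  It is applied to u, to its derivative and to the derivative of
    1 / u, each minus a rational constant; for the first and the third the unwanted
    sign is refuted by integrating back to f ([hardy_sign], [top_derivative_mulx_large]).

    The counting.  Products of the kernels ((1 + cos (2 pi t)) / 2)^K, translated along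
    a grid of the torus, add up to a constant, so that the frequency of a set is
    bounded by the proportion of grid points near it ([freq_le_grid]); passing to
    complements gives lower bounds.  The grid points in question are the integer
    sequences whose extrapolation to the indices below k takes values in a window.
    Adding a constant sequence translates the window, hence only its length matters,
    and the same numbers of integer sequences squeeze the volume of Ckd, covered by
    small cubes ([volume_lattice]).  Hence the frequency is this volume
    ([lattice_density]).

    The volume is at least that of the set where all the partial sums of the
    'C(k - 1, i) y_i lie in [0, 1[, which is contained in Ckd by summation by parts
    ([psum_set_sub_Ckd]). *)

Set Implicit Arguments.
Unset Strict Implicit.
Unset Printing Implicit Defensive.

(** * Asymptotic means *)

Section means.
Variable R : realType.
Implicit Types (u v : nat -> R) (c : R).

Definition has_mean v c := (\sum_(n < N) v n) / N%:R @[N --> \oo] --> c.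

Lemma has_mean_ext u v c : u =1 v -> has_mean u c -> has_mean v c.
Proof. by move=> /funext ->. Qed.

Lemma has_mean_cvg v c : v @ \oo --> c -> has_mean v c.
Proof.
move=> /cesaro h; rewrite /has_mean -cvg_shiftS; apply: cvg_trans h.
apply: near_eq_cvg; near=> n.
by rewrite /arithmetic_mean /= seriesEnat /= big_mkord mulrC.
Unshelve. all: by end_near. Qed.

Lemma has_mean_cst c : has_mean (fun=> c) c.
Proof. by apply: has_mean_cvg; exact: cvg_cst. Qed.

Lemma has_meanD u v a b : has_mean u a -> has_mean v b ->
  has_mean (fun n => u n + v n) (a + b).
Proof.
rewrite /has_mean => hu hv; rewrite (_ : (fun N : nat => _) =
  (fun N : nat => (\sum_(n < N) u n) / N%:R + (\sum_(n < N) v n) / N%:R)).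
  exact: cvgD.
by apply/funext => N; rewrite /= big_split mulrDl.
Qed.

Lemma has_meanZ k v c : has_mean v c -> has_mean (fun n => k * v n) (k * c).
Proof.
rewrite /has_mean => hv; rewrite (_ : (fun N : nat => _) =
  (fun N : nat => k * ((\sum_(n < N) v n) / N%:R))).
  exact: cvgMl_tmp.
by apply/funext => N; rewrite /= -mulr_sumr mulrA.
Qed.

Lemma has_mean_sum (I : Type) (s : seq I) (F : I -> nat -> R) (c : I -> R) :
  (forall i, has_mean (F i) (c i)) ->
  has_mean (fun n => \sum_(i <- s) F i n) (\sum_(i <- s) c i).
Proof.
move=> h; elim: s => [|i s ih].
  by rewrite big_nil; apply: has_mean_ext (@has_mean_cst 0) => n; rewrite big_nil.
by rewrite big_cons; apply: has_mean_ext (has_meanD (h i) ih) => n; rewrite big_cons.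
Qed.

Lemma has_mean_sub u v c :
  (fun n => v n - u n) @ \oo --> 0 -> has_mean u c -> has_mean v c.
Proof.
move=> /has_mean_cvg h hu; rewrite -[c]addr0; have := has_meanD hu h.
by apply: has_mean_ext => n; rewrite addrC subrK.
Qed.

(** The sum telescopes, so it stays bounded by twice the bound of v. *)
Lemma has_mean_shiftB v m B : (forall n, `|v n| <= B) ->
  has_mean (fun n => v (n + m)%N - v n) 0.
Proof.
move=> vB; elim: m => [|m ih].
  by apply: has_mean_ext (@has_mean_cst 0) => n; rewrite addn0 subrr.
set u := fun n => v (n + m)%N in ih *.
suff : has_mean (fun n => u n.+1 - u n) 0.
  move=> h; rewrite -[0]addr0; have := has_meanD ih h.
  by apply: has_mean_ext => n; rewrite addrC addrA subrK /u addSnnS.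
have b0 : (2 * B) / N%:R @[N --> \oo] --> 0.
  rewrite -(mulr0 (2 * B)); apply: cvgMl_tmp.
  by rewrite -cvg_shiftS; exact: cvg_harmonic.
apply: norm_cvg0; apply: (squeeze_cvgr _ (cvg_cst 0) b0).
near=> N; rewrite normr_ge0 /= normrM normfV normr_nat.
rewrite ler_wpM2r ?invr_ge0//.
rewrite -(big_mkord xpredT (fun n => u n.+1 - u n)) telescope_sumr//.
apply: le_trans (ler_normB _ _) _; rewrite mulr_natl mulr2n lerD//; exact: vB.
Unshelve. all: by end_near. Qed.

Lemma has_mean_shift v c m B : (forall n, `|v n| <= B) ->
  has_mean v c -> has_mean (fun n => v (n + m)%N) c.
Proof.
move=> /(has_mean_shiftB m) h hv; rewrite -[c]addr0.
by apply: has_mean_ext (has_meanD hv h) => n; rewrite addrC subrK.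
Qed.

(** A mean is 0 as soon as, for every e, the sequence is within u of a
    sequence of mean 0, where u has a mean at most e: this is how the
    estimates with a free parameter are used. *)
Lemma has_mean0_approx v :
  (forall e : R, 0 < e -> exists w u a, [/\ has_mean w 0, has_mean u a, a <= e &
     forall n, `|v n - w n| <= u n]) -> has_mean v 0.
Proof.
move=> h; apply/cvgr0Pnorm_le => e e0.
have e4 : 0 < e / 4 by rewrite divr_gt0.
have [w [u [a [hw hu ae vwu]]]] := h _ e4.
move/cvgr0Pnorm_le : hw => /(_ _ e4) hw.
move/cvgrPdist_le : hu => /(_ _ e4) hu.
near=> N.
have Hw : `|(\sum_(n < N) w n) / N%:R| <= e / 4 by near: N.
have Hu : `|a - (\sum_(n < N) u n) / N%:R| <= e / 4 by near: N.
have : `|(\sum_(n < N) (v n - w n)) / N%:R| <= (\sum_(n < N) u n) / N%:R.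
  rewrite normrM normfV normr_nat ler_wpM2r ?invr_ge0//.
  by apply: le_trans (ler_norm_sum _ _ _) _; exact: ler_sum.
rewrite big_split /= sumrN mulrBl.
move: Hw Hu; rewrite !ler_norml; lra.
Unshelve. all: by end_near. Qed.

Lemma has_mean_unshift v c m B : (forall n, `|v n| <= B) ->
  has_mean (fun n => v (n + m)%N) c -> has_mean v c.
Proof.
move=> /(has_mean_shiftB m) h hv.
have := has_meanD hv (@has_meanZ (-1) _ _ h); rewrite mulr0 addr0.
by apply: has_mean_ext => n; ring.
Qed.

End means.

(** * Van der Corput's inequality *)

Section exponential.
Variable R : realType.
Implicit Types (F G : nat -> R).

Lemma normr_cos_le1 (x : R) : `|cos x| <= 1.
Proof. by rewrite ler_norml cos_geN1 cos_le1. Qed.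

(** The right-hand side is the squared modulus of the sum of the exponentials,
    of which the sum of the cosines is the real part. *)
Lemma sqr_sum_cos (I : Type) (s : seq I) (x : I -> R) :
  (\sum_(h <- s) cos (x h)) ^+ 2 <= \sum_(h <- s) \sum_(k <- s) cos (x h - x k).
Proof.
have -> : \sum_(h <- s) \sum_(k <- s) cos (x h - x k) =
    (\sum_(h <- s) cos (x h)) ^+ 2 + (\sum_(h <- s) sin (x h)) ^+ 2.
  rewrite !expr2 !mulr_suml -big_split /=; apply: eq_bigr => h _.
  rewrite !mulr_sumr -big_split /=; apply: eq_bigr => k _.
  by rewrite cosB.
by rewrite lerDl sqr_ge0.
Qed.

(** Replacing each term by its average over a window of H shifts does not
    change the mean. The square of a window average has mean at most 1 / H,
    because only the H diagonal pairs of shifts contribute. Weighting the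
    window average w by the inequality 2 |w| <= 1/M + M w^2 with H = M^2
    avoids a Cauchy-Schwarz inequality for means. *)
Lemma van_der_corput F (r : nat) :
  (forall m, (0 < m)%N -> has_mean (fun n => cos (F (n + r * m)%N - F n)) 0) ->
  forall t, has_mean (fun n => cos (F n + t)) 0.
Proof.
move=> hF t; apply: has_mean0_approx => e e0.
have [m me] : exists m : nat, m.+1%:R^-1 < e.
  exists (Num.truncn e^-1); rewrite invf_plt ?posrE//.
  by rewrite truncnS_gt.
pose H := (m.+1 ^ 2)%N.
have H0 : (0 < H)%N by rewrite expn_gt0.
pose c n := cos (F n + t).
pose s n := H%:R^-1 * \sum_(h < H) c (n + r * h)%N.
pose Q n := \sum_(h < H) \sum_(k < H) cos (F (n + r * h)%N - F (n + r * k)%N).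
exists (fun n => c n - s n), (fun n => 2^-1 * (m.+1%:R^-1 + m.+1%:R * (H%:R^-2 * Q n))).
exists (2^-1 * (m.+1%:R^-1 + m.+1%:R * (H%:R^-2 * H%:R))); split.
- have : has_mean (fun n => - H%:R^-1 * \sum_(h < H) (c (n + r * h)%N - c n))
      (- H%:R^-1 * (\sum_(h < H) 0)).
    apply: has_meanZ; apply: has_mean_sum => h.
    by apply: (@has_mean_shiftB _ c _ 1) => n; exact: normr_cos_le1.
  rewrite big1// mulr0; apply: has_mean_ext => n.
  rewrite /s sumrB sumr_const card_ord -mulr_natl; field.
  by rewrite pnatr_eq0 -lt0n.
- apply: has_meanZ; apply: has_meanD; first exact: has_mean_cst.
  do 2 apply: has_meanZ.
  have -> : H%:R = \sum_(h < H) \sum_(k < H) (h == k)%:R :> R.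
    rewrite (eq_bigr (fun=> 1)) ?sumr_const ?card_ord// => h _.
    rewrite (bigD1 h)//= eqxx big1 ?addr0// => k.
    by rewrite eq_sym => /negbTE ->.
  apply: has_mean_sum => h; apply: has_mean_sum => k.
  wlog hk : h k / (h <= k)%N.
    move=> W; have [/W//|/ltnW/W] := leqP h k.
    rewrite eq_sym; apply: has_mean_ext => n.
    by rewrite -cosN opprB.
  move: hk; rewrite leq_eqVlt => /predU1P[/val_inj ->|hk].
    by rewrite eqxx; apply: has_mean_ext (@has_mean_cst _ 1) => n; rewrite subrr cos0.
  rewrite -val_eqE ltn_eqF//.
  have := hF (k - h)%N; rewrite subn_gt0 => /(_ hk) /(has_mean_shift (r * h)).
  move=> /(_ 1 (fun=> normr_cos_le1 _)); apply: has_mean_ext => n.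
  by rewrite -addnA -mulnDr subnKC 1?ltnW// -cosN opprB.
- rewrite ltW//; apply: le_lt_trans me.
  rewrite /H natrX; have : m.+1%:R != 0 :> R by rewrite pnatr_eq0.
  by move=> mn0; rewrite le_eqVlt; apply/orP; left; apply/eqP; field.
- move=> n; rewrite opprB addrC subrK.
  set M : R := m.+1%:R.
  have M0 : 0 < M by rewrite ltr0n.
  clearbody M.
  have : s n ^+ 2 <= H%:R^-2 * Q n.
    rewrite /s exprMn exprVn ler_wpM2l ?invr_ge0 ?sqr_ge0//.
    have := sqr_sum_cos (index_enum 'I_H) (fun h => F (n + r * h)%N + t).
    move=> /le_trans; apply; rewrite /Q.
    apply: ler_sum => h _; apply: ler_sum => k _.
    by rewrite opprD addrACA subrr addr0.
  set q := _ * Q n => sq; clearbody q.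
  have h1 : `|s n| * 2 <= M^-1 + M * s n ^+ 2.
    rewrite -(real_normK (num_real (s n))).
    have : 0 <= M^-1 * (1 - M * `|s n|) ^+ 2.
      by apply: mulr_ge0; [rewrite invr_ge0 ltW|exact: sqr_ge0].
    have -> : M^-1 * (1 - M * `|s n|) ^+ 2 = M^-1 - 2 * `|s n| + M * `|s n| ^+ 2.
      by field; rewrite gt_eqF.
    lra.
  have : M * s n ^+ 2 <= M * q by rewrite ler_wpM2l// ltW.
  lra.
Qed.

End exponential.

(** * Fejer's theorem *)

Section fejer.
Variable R : realType.
Implicit Types (F G : nat -> R).

Lemma cos_lipschitz (x y : R) : `|cos x - cos y| <= `|x - y|.
Proof.
wlog xy : x y / y <= x.
  by move=> W; have [/W//|/ltW/W] := leP y x; rewrite distrC (distrC y).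
have [z _ ->] := @MVT_segment R cos (fun z => - sin z) y x xy
  (fun z _ => is_derive_cos z) (continuous_subspaceT (@continuous_cos R)).
rewrite normrM normrN ler_piMl// ler_norml sin_geN1 sin_le1//.
Qed.

(** The error of the approximation that turns the exponential of a slowly
    varying phase into a discrete derivative. *)
Lemma sin_taylor1 (x h : R) : 0 <= h ->
  `|sin (x + h) - sin x - h * cos x| <= h * h.
Proof.
move=> h0; have xh : x <= x + h by rewrite lerDl.
have [z zx ->] := @MVT_segment R sin cos x (x + h) xh
  (fun z _ => is_derive_sin z) (continuous_subspaceT (@continuous_sin R)).
rewrite addrAC subrr add0r (mulrC (cos z)) -mulrBr normrM ger0_norm// ler_wpM2l//.
apply: le_trans (cos_lipschitz _ _) _.
move: zx; rewrite in_itv/= => /andP[? ?]; rewrite ler_norml; lra.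
Qed.

(** With a n = G n.+1 - G n, the term cos (G n + t) is (sin (G n.+1 + t) - sin
    (G n + t)) / a n up to O(a n), and the first part is summed by parts:
    since 1 / a is monotone, its partial sums are at most 2 / a N = o(N). *)
Lemma fejer_from0 G (a := fun n => G n.+1 - G n) :
  (forall n, 0 < a n) -> (forall n, a n.+1 <= a n) -> a @ \oo --> 0 ->
  n%:R * a n @[n --> \oo] --> +oo ->
  forall t, has_mean (fun n => cos (G n + t)) 0.
Proof.
move=> a0 a_decr a_cvg0 na_cvgy t.
pose S n := sin (G n + t).
have S1 n : `|S n| <= 1 by rewrite ler_norml sin_geN1 sin_le1.
pose w n := (a n)^-1 * (S n.+1 - S n).
(* Summation by parts in the form of an induction: the boundary term grows by
   exactly the increment of 1 / a. *)
have Hw N : `|\sum_(n < N) w n - (a N)^-1 * S N| <= (a N)^-1.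
  elim: N => [|N ih].
    rewrite big_ord0 sub0r normrN normrM gtr0_norm ?invr_gt0//.
    by rewrite ler_piMr// invr_ge0 ltW.
  rewrite big_ord_recr /= {2}/w.
  have -> : \sum_(i < N) w i + (a N)^-1 * (S N.+1 - S N) - (a N.+1)^-1 * S N.+1 =
    (\sum_(i < N) w i - (a N)^-1 * S N) - ((a N.+1)^-1 - (a N)^-1) * S N.+1.
    by ring.
  apply: le_trans (ler_normB _ _) _.
  rewrite -lerBrDl; apply: le_trans (_ : (a N.+1)^-1 - (a N)^-1 <= _).
    rewrite normrM ger0_norm; last by rewrite subr_ge0 lef_pV2 ?posrE.
    by rewrite ler_piMr// subr_ge0 lef_pV2 ?posrE.
  by rewrite lerB.
apply: (@has_mean_sub _ w).
  apply: norm_cvg0; apply: (squeeze_cvgr _ (cvg_cst 0) a_cvg0).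
  apply: nearW => n; rewrite normr_ge0 /=.
  have -> : cos (G n + t) - w n = - ((a n)^-1 * (S n.+1 - S n - a n * cos (G n + t))).
    by rewrite /w; field; rewrite gt_eqF.
  rewrite normrN normrM gtr0_norm ?invr_gt0// mulrC ler_pdivrMr//.
  rewrite /S (_ : G n.+1 + t = (G n + t) + a n); last by rewrite /a; ring.
  exact/sin_taylor1/ltW.
have b0 : 2 * (N%:R * a N)^-1 @[N --> \oo] --> 0.
  rewrite -(mulr0 2); apply: cvgMl_tmp.
  rewrite gtr0_cvgV0 => //; near=> n; rewrite mulr_gt0// ltr0n; near: n.
  exact: nbhs_infty_gt.
apply: norm_cvg0; apply: (squeeze_cvgr _ (cvg_cst 0) b0).
apply: nearW => N; rewrite normr_ge0 /= normrM normfV normr_nat.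
rewrite invfM [N%:R^-1 * _]mulrC mulrA ler_wpM2r ?invr_ge0//.
have : `|(a N)^-1 * S N| <= (a N)^-1.
  rewrite normrM gtr0_norm ?invr_gt0//.
  by rewrite ler_piMr// invr_ge0 ltW.
move: (Hw N); set p := _ * S N; rewrite !ler_norml; lra.
Unshelve. all: by end_near. Qed.

(** Reduction to the previous case: dropping finitely many terms does not
    change a mean. *)
Lemma fejer G (a := fun n => G n.+1 - G n) :
  (\forall n \near \oo, 0 < a n) -> (\forall n \near \oo, a n.+1 <= a n) ->
  a @ \oo --> 0 -> n%:R * a n @[n --> \oo] --> +oo ->
  forall t, has_mean (fun n => cos (G n + t)) 0.
Proof.
move=> [m1 _ h1] [m2 _ h2] h3 h4 t; pose m := maxn m1 m2.
have mm1 n : (m1 <= n + m)%N by rewrite (leq_trans (leq_maxl m1 m2))// leq_addl.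
have mm2 n : (m2 <= n + m)%N by rewrite (leq_trans (leq_maxr m1 m2))// leq_addl.
apply: (@has_mean_unshift _ _ _ m 1) => [n|]; first exact: normr_cos_le1.
apply: (@fejer_from0 (fun n => G (n + m)%N)) => [n|n||].
- exact: h1 (mm1 n).
- exact: h2 (mm2 n).
- exact: (cvg_comp (addn^~ m) a (cvg_addnr m) h3).
- have h4' : (n + m)%:R * a (n + m)%N @[n --> \oo] --> +oo.
    exact: (cvg_comp (addn^~ m) (fun n => n%:R * a n) (cvg_addnr m) h4).
  apply/cvgryPge => A.
  move/cvgryPge : h4' => /(_ (2 * A)) h4'.
  near=> n.
  have : 2 * A <= (n + m)%:R * a (n + m)%N by near: n.
  have : (m <= n)%N by near: n; exact: nbhs_infty_ge.
  have := h1 _ (mm1 n); rewrite -/(a _) => an.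
  move=> mn h; rewrite -(ler_pM2l (ltr0n R 2)) (le_trans h)// mulrA ler_wpM2r ?(ltW an)//.
  by move: mn; rewrite -(ler_nat R) natrD; lra.
Unshelve. all: by end_near. Qed.

End fejer.

(** * Integer combinations of the shifts of a sequence *)

Section shift_operators.
Variables (R : realType) (r : nat).
Implicit Types (P Q : {poly int}) (a : nat -> R).

(** Z[X] acts on sequences, X being the shift by r: the integer combinations
    of the shifts of a are the values of this action, and composition is the
    product of polynomials. *)
Definition act P a (n : nat) : R := \sum_(i < size P) (P`_i)%:~R * a (n + r * i)%N.

Lemma act_widen m P a n : (size P <= m)%N ->
  act P a n = \sum_(i < m) (P`_i)%:~R * a (n + r * i)%N.
Proof.
move=> Pm; rewrite /act (big_ord_widen m (fun i => (P`_i)%:~R * a (n + r * i)%N))//.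
rewrite big_mkcond; apply: eq_bigr => i _; case: ltnP => // Pi.
by rewrite nth_default// mul0r.
Qed.

Lemma actD P Q a n : act (P + Q) a n = act P a n + act Q a n.
Proof.
pose m := maxn (size P) (size Q).
rewrite (@act_widen m (P + Q)) ?size_polyD// (@act_widen m P) ?leq_maxl//.
rewrite (@act_widen m Q) ?leq_maxr// -big_split; apply: eq_bigr => i _.
by rewrite coefD rmorphD mulrDl.
Qed.

Lemma actZ c P a n : act (c *: P) a n = c%:~R * act P a n.
Proof.
rewrite (@act_widen (size P)) ?size_scale_leq// mulr_sumr.
by apply: eq_bigr => i _; rewrite coefZ rmorphM mulrA.
Qed.

Lemma actB P Q a n : act (P - Q) a n = act P a n - act Q a n.
Proof. by rewrite -scaleN1r actD actZ mulN1r. Qed.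

Lemma actC c a n : act c%:P a n = c%:~R * a n.
Proof.
rewrite (@act_widen 1) ?size_polyC_leq1// big_ord1 coefC eqxx.
by rewrite muln0 addn0.
Qed.

Lemma act1 a n : act 1 a n = a n.
Proof. by rewrite actC mul1r. Qed.

Lemma actMX P a n : act (P * 'X) a n = act P a (n + r)%N.
Proof.
rewrite (@act_widen (size P).+1); last first.
  by rewrite (leq_trans (size_polyMleq _ _))// size_polyX addn2.
rewrite big_ord_recl coefMX eqxx mul0r add0r; apply: eq_bigr => i _.
by rewrite coefMX /= add0n mulnS addnA.
Qed.

Lemma actM P Q a n : act (P * Q) a n = act P (act Q a) n.
Proof.
elim/poly_ind: P n => [|P c ih] n.
  by rewrite mul0r /act size_poly0 !big_ord0.
rewrite mulrDl !actD mulrAC !actMX ih mul_polyC actZ actC.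
by [].
Qed.

Lemma actXn m a n : act 'X^m a n = a (n + r * m)%N.
Proof.
elim: m n => [|m ih] n; first by rewrite expr0 act1 muln0 addn0.
by rewrite exprSr actMX ih mulnS addnA.
Qed.

Lemma cvg0Ml (c : R) (u : nat -> R) : u @ \oo --> 0 -> c * u n @[n --> \oo] --> 0.
Proof.
move=> u0; have : (fun n => c * u n) @ \oo --> c * 0 by exact: cvgMl_tmp.
by rewrite mulr0.
Qed.

Lemma cvg0_sum (I : Type) (s : seq I) (F : I -> nat -> R) :
  (forall i, F i @ \oo --> 0) -> (\sum_(i <- s) F i n) @[n --> \oo] --> 0.
Proof.
move=> F0; elim: s => [|i s ih].
  by under eq_fun do rewrite big_nil; exact: cvg_cst.
have h : (fun n => F i n + \sum_(j <- s) F j n) @ \oo --> 0 + 0 by exact: cvgD.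
move: h; rewrite addr0; apply: cvg_trans.
by apply: near_eq_cvg; apply: nearW => n; rewrite big_cons.
Qed.

Lemma act_cvg0 P a : a @ \oo --> 0 -> act P a @ \oo --> 0.
Proof.
move=> a0; apply: cvg0_sum => i; apply: cvg0Ml.
exact: (cvg_comp (addn^~ (r * i)%N) a (cvg_addnr _) a0).
Qed.

(** When the differences of a tend to 0, all the shifts of a are
    asymptotically equal, so P acts like the number P(1). *)
Lemma act_near_horner P a : a n.+1 - a n @[n --> \oo] --> 0 ->
  act P a n - P.[1]%:~R * a n @[n --> \oo] --> 0.
Proof.
move=> da0; have am m : a (n + m)%N - a n @[n --> \oo] --> 0.
  elim: m => [|m ih].
    by under eq_fun do rewrite addn0 subrr; exact: cvg_cst.
  have h : (fun n => a (n + m).+1 - a (n + m)%N) @ \oo --> 0.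
    exact: (cvg_comp (addn^~ m) (fun n => a n.+1 - a n) (cvg_addnr _) da0).
  have {h ih} : (fun n => (a (n + m).+1 - a (n + m)%N) + (a (n + m)%N - a n)) @ \oo --> 0 + 0.
    exact: cvgD.
  by rewrite addr0; under eq_fun do rewrite addrA subrK -addnS.
rewrite (_ : (fun n => _) =
  (fun n => \sum_(i < size P) (P`_i)%:~R * (a (n + r * i)%N - a n))).
  by apply: cvg0_sum => i; apply: cvg0Ml.
apply/funext => n; rewrite horner_coef rmorph_sum mulr_suml -sumrB.
by apply: eq_bigr => i _; rewrite expr1n mulr1 mulrBr.
Qed.

(** Write P = Q (X - 1)^i with Q(1) <> 0. Shifting by r m multiplies P by X^m,
    so van der Corput's inequality replaces P by (X^m - 1) P, whose order of
    vanishing at 1 is i + 1. After d - i steps the sequence becomes Q acting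
    on g, which behaves like the multiple Q(1) of g, and Fejer's theorem
    applies. *)
Lemma polynomial_equidistribution (a : nat -> R) d (g := act (('X - 1) ^+ d) a) :
  (\forall n \near \oo, 0 < g n.+1 - g n) ->
  (\forall n \near \oo, g n.+2 - g n.+1 <= g n.+1 - g n) ->
  g n.+1 - g n @[n --> \oo] --> 0 ->
  n%:R * (g n.+1 - g n) @[n --> \oo] --> +oo ->
  forall P, P != 0 -> (size P <= d.+1)%N ->
  forall t, has_mean (fun n => cos (2 * pi * act P a n + t)) 0.
Proof.
move=> h1 h2 h3 h4.
have pi20 : 0 < 2 * pi :> R by rewrite mulr_gt0// pi_gt0.
have base P : P.[1] != 0 ->
    forall t, has_mean (fun n => cos (2 * pi * act P g n + t)) 0.
  move=> P1 t.
  apply: (@has_mean_sub _ (fun n => cos (2 * pi * (P.[1]%:~R * g n) + t))).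
    have h : `|2 * pi| * `|act P g n - P.[1]%:~R * g n| @[n --> \oo] --> 0.
      by apply: cvg0Ml; apply/norm_cvg0P; exact: act_near_horner.
    apply: norm_cvg0; apply: (squeeze_cvgr _ (cvg_cst 0) h).
    apply: nearW => n; rewrite normr_ge0/= (le_trans (cos_lipschitz _ _))//.
    by rewrite opprD addrACA subrr addr0 -mulrBr normrM.
  have pos c s : 0 < c -> has_mean (fun n => cos (c * g n + s)) 0.
    move=> c0; apply: (@fejer _ (fun n => c * g n)).
    - by near do rewrite -mulrBr pmulr_rgt0//.
    - by near do rewrite -!mulrBr ler_pM2l//.
    - by under eq_fun do rewrite -mulrBr; exact: cvg0Ml.
    - under eq_fun do rewrite -mulrBr mulrCA.
      apply/cvgryPge => A; move/cvgryPge : h4 => /(_ (A / c)).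
      by apply: filterS => n; rewrite ler_pdivrMr// mulrC.
  have : P.[1]%:~R != 0 :> R by rewrite intr_eq0.
  rewrite neq_lt => /orP[P1lt|P1gt]; last first.
    have := @pos (2 * pi * P.[1]%:~R) t (mulr_gt0 pi20 P1gt).
    by apply: has_mean_ext => n; rewrite mulrA.
  have := @pos (- (2 * pi * P.[1]%:~R)) (- t).
  rewrite oppr_gt0 pmulr_rlt0// => /(_ P1lt).
  by apply: has_mean_ext => n; rewrite mulNr -opprD cosN mulrA.
(* Induction on d - i; the quotient of X^m - 1 by X - 1 takes the nonzero
   value m at 1. *)
have main e i : (i + e = d)%N -> forall P, P.[1] != 0 ->
    forall t, has_mean (fun n => cos (2 * pi * act (P * ('X - 1) ^+ i) a n + t)) 0.
  elim: e i => [|e ih] i.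
    rewrite addn0 => -> P P1 t; have := base P P1 t.
    by apply: has_mean_ext => n; rewrite actM.
  move=> id P P1; apply: (@van_der_corput _ _ r) => m m0.
  have im : (i.+1 + e = d)%N by rewrite addSnnS.
  have Q1 : ((\sum_(l < m) 'X^l) * P).[1] != 0.
    rewrite hornerM mulf_neq0// horner_sum.
    rewrite (eq_bigr (fun=> 1)) ?sumr_const ?card_ord ?pnatr_eq0 -?lt0n//.
    by move=> l _; rewrite hornerXn expr1n.
  apply: has_mean_ext (ih _ im _ Q1 0) => n.
  rewrite addr0 -mulrBr -actXn; congr (cos (_ * _)).
  rewrite -actM -actB; congr (act _ _ _).
  rewrite -[X in _ = _ - X]mul1r -mulrBl subrX1 exprS. ring.
move=> P P0 sP; have [m [Q]] := multiplicity_XsubC P 1.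
rewrite P0 /= => Q1 PE; rewrite PE; apply: (main (d - m)%N) => //.
rewrite subnKC//; have Q0 : Q != 0 by apply: contraNneq Q1 => ->; rewrite root0.
move: sP; rewrite PE size_Mmonic ?monic_exp ?monicXsubC// size_exp_XsubC.
rewrite addnS /=; move: Q0; rewrite -size_poly_gt0 => q0 h.
by rewrite -ltnS (leq_trans _ h)// -add1n leq_add2r.
Unshelve. all: by end_near. Qed.

End shift_operators.

(** * A trigonometric approximation of the identity *)

Section kernel.
Variable R : realType.

(** Even trigonometric polynomials of degree at most K. The coefficients stay
    existential: the constant term is recovered as an average over a grid. *)
Definition cospoly K (f : R -> R) := exists b : nat -> R,
  forall x, f x = \sum_(k < K.+1) b k * cos (k%:R * x).

Lemma cospoly_ext K f g : f =1 g -> cospoly K f -> cospoly K g.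
Proof. by move=> /funext ->. Qed.

Lemma cospolyD K f g : cospoly K f -> cospoly K g -> cospoly K (fun x => f x + g x).
Proof.
move=> [b fE] [c gE]; exists (fun k => b k + c k) => x.
by rewrite fE gE -big_split; apply: eq_bigr => k _; rewrite mulrDl.
Qed.

Lemma cospolyZ K c f : cospoly K f -> cospoly K (fun x => c * f x).
Proof.
move=> [b fE]; exists (fun k => c * b k) => x.
by rewrite fE mulr_sumr; apply: eq_bigr => k _; rewrite mulrA.
Qed.

Lemma cospoly_cos K k : (k <= K)%N -> cospoly K (fun x => cos (k%:R * x)).
Proof.
move=> kK; exists (fun j => (j == k)%:R) => x.
have kK' : (k < K.+1)%N by [].
rewrite (bigD1 (Ordinal kK'))//= eqxx mul1r big1 ?addr0// => j.
by rewrite -val_eqE /= => /negbTE ->; rewrite mul0r.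
Qed.

Lemma cospoly_sum K (I : Type) (s : seq I) (f : I -> R -> R) :
  (forall i, cospoly K (f i)) -> cospoly K (fun x => \sum_(i <- s) f i x).
Proof.
move=> h; elim: s => [|i s ih].
  by exists (fun=> 0) => x; rewrite big_nil big1// => k _; rewrite mul0r.
by apply: cospoly_ext (cospolyD (h i) ih) => x; rewrite big_cons.
Qed.

Lemma cosM (x y : R) : cos x * cos y = 2^-1 * cos (x + y) + 2^-1 * cos (x - y).
Proof. by rewrite cosD cosB; field. Qed.

Lemma cospoly_kernel K : cospoly K (fun x => ((1 + cos x) / 2) ^+ K).
Proof.
elim: K => [|K [b ih]].
  by apply: cospoly_ext (cospoly_cos (leqnn 0)) => x; rewrite mul0r cos0 expr0.
pose f (k : 'I_K.+1) x := b k * (2^-1 * cos (k%:R * x) +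
  (4^-1 * cos (k.+1%:R * x) + 4^-1 * cos (k%:R * x - x))).
apply: (@cospoly_ext _ (fun x => \sum_(k <- index_enum 'I_K.+1) f k x)).
  move=> x; rewrite exprS ih mulr_sumr; apply: eq_bigr => k _.
  have -> : (1 + cos x) / 2 * (b k * cos (k%:R * x)) =
    b k * (2^-1 * cos (k%:R * x) + 2^-1 * (cos (k%:R * x) * cos x)) by field.
  by rewrite /f cosM -[k.+1%:R]natr1 mulrDl mul1r; field.
apply: cospoly_sum => k; apply: cospolyZ; apply: cospolyD.
  by apply/cospolyZ/cospoly_cos/ltnW/ltn_ord.
apply: cospolyD; first by apply/cospolyZ/cospoly_cos/ltn_ord.
apply: cospolyZ; case: k => -[|k] /= kK.
  apply: (@cospoly_ext _ (fun x => cos (1%:R * x))); last exact: cospoly_cos.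
  by move=> x; rewrite mul0r sub0r cosN mul1r.
apply: (@cospoly_ext _ (fun x => cos (k%:R * x))).
  by move=> x; rewrite -[k.+1%:R]natr1 mulrDl mul1r addrK.
by apply: cospoly_cos; rewrite 2?ltnW.
Qed.

Lemma sin_natpi (k : nat) (x : R) : sin (x - 2 * pi * k%:R) = sin x.
Proof.
elim: k => [|k ih]; first by rewrite mulr0 subr0.
rewrite -[RHS]ih -[LHS]sinD2pi; congr sin.
 rewrite -[k.+1%:R]natr1; ring.
Qed.

Lemma cos_natpi (k : nat) (x : R) : cos (x + 2 * pi * k%:R) = cos x.
Proof.
elim: k => [|k ih]; first by rewrite mulr0 addr0.
rewrite -[RHS]ih -[RHS]cosD2pi; congr cos.
 rewrite -[k.+1%:R]natr1; ring.
Qed.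

Lemma cos_intpi (m : int) (x : R) : cos (x + 2 * pi * m%:~R) = cos x.
Proof.
case: m => k; first exact: cos_natpi.
by rewrite NegzE mulrNz mulrN -pmulrn -[LHS](cos_natpi k.+1) subrK.
Qed.

(** A nonconstant frequency below L averages to 0 over the grid of step 1 / L:
    after multiplication by twice the sine of half the step the sum telescopes
    over a whole period. *)
Lemma sum_cos_grid (L k : nat) (t : R) : (k < L)%N ->
  \sum_(p < L) cos (k%:R * (2 * pi * (t - p%:R / L%:R))) = (L * (k == 0))%:R.
Proof.
case: k => [|k] kL.
  rewrite eqxx muln1 (eq_bigr (fun=> 1)) ?sumr_const ?card_ord// => p _.
  by rewrite mul0r cos0.
rewrite muln0; have L0 : 0 < L%:R :> R by rewrite ltr0n (leq_ltn_trans _ kL).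
pose a : R := pi * k.+1%:R / L%:R.
have sa : 0 < sin a.
  apply: sin_gt0_pi; rewrite /a divr_gt0 ?mulr_gt0 ?pi_gt0//=.
  by rewrite ltr_pdivrMr// ltr_pM2l ?pi_gt0// ltr_nat.
apply: (mulIf (_ : 2 * sin a != 0)); first by rewrite gt_eqF// mulr_gt0.
rewrite mul0r mulr_suml.
pose b : R := k.+1%:R * (2 * pi * t).
pose f (p : nat) := sin (b + a - 2 * a * p%:R).
rewrite (eq_bigr (fun p : 'I_L => - (f p.+1 - f p))) => [|p _].
  rewrite sumrN -(big_mkord xpredT (fun p => f p.+1 - f p)) telescope_sumr//.
  rewrite /f mulr0 subr0 (_ : 2 * a * L%:R = 2 * pi * k.+1%:R).
    by rewrite sin_natpi subrr oppr0.
  by rewrite /a; field; rewrite gt_eqF.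
set x := _ * (_ * _); have xE : x = b - 2 * a * p%:R.
  by rewrite /x /b /a; field; rewrite gt_eqF.
have -> : f p = sin (x + a) by rewrite /f xE; congr sin; ring.
have -> : f p.+1 = sin (x - a) by rewrite /f xE -[p.+1%:R]natr1; congr sin; ring.
by rewrite sinB sinD; ring.
Qed.

(** A nonnegative trigonometric polynomial of degree K that decays
    exponentially in K away from the integers, since its base is the square of
    the cosine of pi t. *)
Definition kernel K (t : R) := ((1 + cos (2 * pi * t)) / 2) ^+ K.

Lemma kernel_base (t : R) : 0 <= (1 + cos (2 * pi * t)) / 2 <= 1.
Proof.
have := cos_geN1 (2 * pi * t); have := cos_le1 (2 * pi * t); lra.
Qed.

Lemma kernel_ge0 K t : 0 <= kernel K t.
Proof. by apply: exprn_ge0; case/andP: (kernel_base t). Qed.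

Lemma kernel_le1 K t : kernel K t <= 1.
Proof. by case/andP: (kernel_base t) => *; apply: exprn_ile1. Qed.

(** The mean b 0 of the kernel is computed by averaging over a grid finer than
    its degree, so the translates of the kernel by that grid form a partition
    of a constant; the constant is at least the value 1 of the kernel at 0. *)
Lemma kernel_expansion K : exists b : nat -> R,
  [/\ forall t, kernel K t = \sum_(k < K.+1) b k * cos (k%:R * (2 * pi * t)),
      forall t, \sum_(p < K.+1) kernel K (t - p%:R / K.+1%:R) = K.+1%:R * b 0%N &
      1 <= K.+1%:R * b 0%N].
Proof.
have [b bE] := cospoly_kernel K; exists b.
have kE t : kernel K t = \sum_(k < K.+1) b k * cos (k%:R * (2 * pi * t)).
  exact: bE.
have sE t : \sum_(p < K.+1) kernel K (t - p%:R / K.+1%:R) = K.+1%:R * b 0%N.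
  under eq_bigr => p _ do rewrite kE.
  rewrite exchange_big big_ord_recl /= -mulr_sumr sum_cos_grid// muln1.
  rewrite big1 ?addr0; first by rewrite mulrC.
  move=> k _.
  by rewrite -mulr_sumr sum_cos_grid ?muln0 ?mulr0 ?ltnS ?ltn_ord.
split => //; rewrite -(sE 0) big_ord_recl /= mul0r subr0.
rewrite /kernel mulr0 cos0 divff// expr1n lerDl sumr_ge0// => p _; exact: kernel_ge0.
Qed.

(** The cosine decreases on the half-period, and t is at distance at most 1/2
    from an integer. *)
Lemma kernel_tail K (e t : R) : 0 < e -> e < 2^-1 ->
  (forall m : int, e <= `|t - m%:~R|) -> kernel K t <= kernel K e.
Proof.
move=> e0 e2 te; apply: lerXn2r.
- by rewrite nnegrE; case/andP: (kernel_base t).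
- by rewrite nnegrE; case/andP: (kernel_base e).
rewrite ler_pM2r ?invr_gt0// lerD2l.
pose m := Num.floor (t + 2^-1); pose s := `|t - m%:~R|.
have pi0 : 0 < pi :> R := pi_gt0 _.
have -> : cos (2 * pi * t) = cos (2 * pi * s).
  have -> : cos (2 * pi * s) = cos (2 * pi * (t - m%:~R)).
    by rewrite /s; case: (ger0P (t - m%:~R)) => // _; rewrite mulrN cosN.
  by rewrite -[RHS](cos_intpi m); congr cos; ring.
have es : e <= s by exact: te.
have s2 : s <= 2^-1.
  have := floor_itv (t + 2^-1); rewrite -/m intrD1.
  by rewrite /s ler_norml; lra.
rewrite leNgt; apply/negP; rewrite ltr_cos ?in_itv /=.
- by rewrite ltr_pM2l ?mulr_gt0// ltNge es.
- by apply/andP; split; nra.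
- by apply/andP; split; nra.
Qed.

Lemma kernel_lt1 (e : R) : 0 < e -> e < 2^-1 -> (1 + cos (2 * pi * e)) / 2 < 1.
Proof.
move=> e0 e2; have pi0 : 0 < pi :> R := pi_gt0 _.
suff : cos (2 * pi * e) < cos 0 by rewrite cos0; lra.
rewrite ltr_cos ?in_itv /= ?lexx ?pi_ge0 ?mulr_gt0//.
by apply/andP; split; nra.
Qed.

End kernel.

Section geometric.
Variable R : realType.

(** Induction on q: one factor n is absorbed by a power of the square root of
    x, since n s^n is at most the sum of the geometric series of s. *)
Lemma natr_exp_bounded q (x : R) : 0 <= x < 1 ->
  exists B : R, forall n, n%:R ^+ q * x ^+ n <= B.
Proof.
elim: q x => [|q ih] x /andP[x0 x1].
  by exists 1 => n; rewrite expr0 mul1r exprn_ile1// ltW.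
have s0 := sqrtr_ge0 x; have s1 : Num.sqrt x < 1 by rewrite -sqrtr1 ltr_sqrt.
have [|B hB] := ih (Num.sqrt x); first by rewrite s0 s1.
exists ((1 - Num.sqrt x)^-1 * B) => n; have xE := sqr_sqrtr x0.
set s := Num.sqrt x in s0 s1 hB xE *.
rewrite (_ : _ * _ = (n%:R * s ^+ n) * (n%:R ^+ q * s ^+ n)); last first.
  by rewrite -xE [n%:R ^+ _]exprS -exprM mul2n -addnn exprD; ring.
apply: ler_pM => //; rewrite ?mulr_ge0 ?exprn_ge0//.
have s1' : 1 - s != 0 by rewrite gt_eqF// subr_gt0.
have h : \sum_(i < n) s ^+ i <= (1 - s)^-1.
  rewrite -[leLHS](mulfK s1') -[leRHS]mul1r ler_pM2r ?invr_gt0 ?subr_gt0//.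
  rewrite mulrC -opprB mulNr -subrX1 opprB gerBl exprn_ge0//.
apply: le_trans h; rewrite mulr_natl (_ : _ *+ n = \sum_(i < n) s ^+ n).
  by apply: ler_sum => i _; apply: ler_wiXn2l; [exact: s0|exact: ltW|exact: ltnW].
by rewrite sumr_const card_ord.
Qed.

Lemma natr_exp_cvg0 q (x : R) : 0 <= x < 1 -> n%:R ^+ q * x ^+ n @[n --> \oo] --> 0.
Proof.
move=> x01; have [B hB] := natr_exp_bounded q.+1 x01.
have h : (fun n => B * n%:R^-1) @ \oo --> 0.
  by apply: cvg0Ml; rewrite -cvg_shiftS; exact: cvg_harmonic.
case/andP: x01 => x0 _.
apply: (squeeze_cvgr _ (cvg_cst 0) h); near=> n.
rewrite mulr_ge0 ?exprn_ge0//=.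
have n0 : 0 < n%:R :> R by rewrite ltr0n; near: n; exact: nbhs_infty_gt.
by rewrite ler_pdivlMr// mulrAC -exprSr.
Unshelve. all: by end_near. Qed.

End geometric.

(** * From exponential sums to counting *)

Section weyl_criterion.
Variables (R : realType) (d : nat) (w : nat -> 'I_d.+1 -> R).
Hypothesis weyl : forall h : 'I_d.+1 -> int, (exists i, h i != 0) ->
  forall t, has_mean (fun n => cos (2 * pi * (\sum_i (h i)%:~R * w n i) + t)) 0.

Let shift_freq (h : 'I_d.+1 -> int) j c n :
  \sum_i (h i + (if i == j then c else 0))%:~R * w n i =
  \sum_i (h i)%:~R * w n i + c%:~R * w n j.
Proof.
under eq_bigr => i _ do rewrite rmorphD mulrDl.
rewrite big_split/=; congr (_ + _); rewrite (bigD1 j)//= eqxx big1 ?addr0// => i.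
by move=> /negbTE ->; rewrite mul0r.
Qed.

(** Product-to-sum formulas turn the product into a combination of cosines
    whose frequency vectors have components k i and - k i. The induction
    treats one coordinate at a time and carries the accumulated frequency h. *)
Lemma has_mean_prod_cos (k : 'I_d.+1 -> nat) (a : 'I_d.+1 -> R) :
  has_mean (fun n => \prod_i cos ((k i)%:R * (2 * pi * (w n i - a i))))
    [forall i, k i == 0%N]%:R.
Proof.
case: forallP => [k0|/forallP/existsP[i0 ki0]].
  apply: has_mean_ext (@has_mean_cst _ 1) => n; rewrite big1// => i _.
  by rewrite (eqP (k0 i)) mul0r cos0.
suff main (s : seq 'I_d.+1) (h : 'I_d.+1 -> int) t : uniq s ->
    (forall i, i \in s -> h i = 0) ->
    (exists2 i, i \in s & k i != 0%N) \/ (exists i, h i != 0) ->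
    has_mean (fun n => \prod_(i <- s) cos ((k i)%:R * (2 * pi * (w n i - a i))) *
      cos (2 * pi * (\sum_i (h i)%:~R * w n i) + t)) 0.
  have i0in : i0 \in index_enum 'I_d.+1 by exact: mem_index_enum.
  have := main _ (fun=> 0) 0 (index_enum_uniq _) (fun _ _ => erefl)
    (or_introl (ex_intro2 _ _ i0 i0in ki0)).
  apply: has_mean_ext => n;
  rewrite [X in _ * cos (_ * X + _)]big1 ?mulr0 ?addr0 ?cos0 ?mulr1// => i _.
  by rewrite mul0r.
elim: s h t => [|j s ih] h t.
  move=> _ _ [[//]|h0]; apply: has_mean_ext (weyl h0 t) => n.
  by rewrite big_nil mul1r.
move=> /= /andP[js us] h0 nz.
pose hc (c : int) i := h i + (if i == j then c else 0).
have step (c : int) (s' : R) : `|c|%N = k j ->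
    has_mean (fun n => \prod_(i <- s) cos ((k i)%:R * (2 * pi * (w n i - a i))) *
      cos (2 * pi * (\sum_i (hc c i)%:~R * w n i) + s')) 0.
  move=> ckj; apply: ih => // [i si|].
    rewrite /hc h0 ?inE ?si ?orbT// add0r ifF//.
    by apply: contraNF js => /eqP <-.
  have hj : h j = 0 by rewrite h0// inE eqxx.
  have [kj0|kj0] := eqVneq (k j) 0%N; last first.
    by right; exists j; rewrite /hc eqxx hj add0r -absz_eq0 ckj.
  have c0 : c = 0 by apply/eqP; rewrite -absz_eq0 ckj kj0.
  case: nz => [[i]|[i hi]].
    rewrite inE => /predU1P[->|si ki]; first by rewrite kj0.
    by left; exists i.
  by right; exists i; rewrite /hc c0; case: ifP; rewrite addr0.
pose c : int := k j.
have := has_meanD (@has_meanZ _ 2^-1 _ _ (step c (t - 2 * pi * c%:~R * a j) erefl))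
  (@has_meanZ _ 2^-1 _ _ (step (- c) (t + 2 * pi * c%:~R * a j) (abszN _))).
rewrite mulr0 addr0; apply: has_mean_ext => n; rewrite big_cons /=.
set P := \prod_(i <- s) _; rewrite /hc !shift_freq.
set S := \sum_i _; set x := (k j)%:R * _; set y := 2 * pi * S + t.
have -> : 2 * pi * (S + c%:~R * w n j) + (t - 2 * pi * c%:~R * a j) = y + x.
  by rewrite /x /y /c -pmulrn; ring.
have -> : 2 * pi * (S + (- c)%:~R * w n j) + (t + 2 * pi * c%:~R * a j) = y - x.
  by rewrite /x /y /c rmorphN /= -pmulrn; ring.
by rewrite (mulrC (cos x)) -mulrA (mulrC (cos x)) cosM; ring.
Qed.

Let kernel_prod K (p : 'I_d.+1 -> nat) n : R :=
  \prod_i kernel K (w n i - (p i)%:R / K.+1%:R).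

(** Only the constant term of the product of trigonometric polynomials has a
    nonzero mean. *)
Lemma has_mean_kernel_prod K (b : nat -> R) (p : 'I_d.+1 -> nat) :
  (forall t, kernel K t = \sum_(k < K.+1) b k * cos (k%:R * (2 * pi * t))) ->
  has_mean (kernel_prod K p) (b 0%N ^+ d.+1).
Proof.
move=> bE; pose c (k : {ffun 'I_d.+1 -> 'I_K.+1}) := \prod_i b (k i).
have := @has_mean_sum _ _ (index_enum {ffun 'I_d.+1 -> 'I_K.+1}) _ _
  (fun k => @has_meanZ _ (c k) _ _
    (@has_mean_prod_cos (fun i => k i : nat) (fun i => (p i)%:R / K.+1%:R))).
rewrite (bigD1 [ffun=> ord0])//= [X in _ + X]big1 ?addr0; last first.
  move=> k; case: forallP => [k0|]; rewrite ?mulr0// => /eqP[].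
  by apply/ffunP => i; apply/val_inj/eqP; rewrite ffunE k0.
rewrite (_ : [forall i, _]); last by apply/forallP => i; rewrite ffunE.
rewrite mulr1 /c (eq_bigr (fun=> b 0%N)) => [|i _]; last by rewrite ffunE.
rewrite prodr_const card_ord; apply: has_mean_ext => n.
rewrite /kernel_prod; under [RHS]eq_bigr => i _ do rewrite bE.
rewrite bigA_distr_bigA /=; apply: eq_bigr => k _.
by rewrite /c -big_split.
Qed.

Lemma sum_kernel_prod K (b0 : R) n :
  (forall t, \sum_(p < K.+1) kernel K (t - p%:R / K.+1%:R) = K.+1%:R * b0) ->
  \sum_(p : {ffun 'I_d.+1 -> 'I_K.+1}) kernel_prod K (fun i => p i) n =
    (K.+1%:R * b0) ^+ d.+1.
Proof.
move=> bE; rewrite /kernel_prod.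
rewrite -(bigA_distr_bigA (fun i (j : 'I_K.+1) => kernel K (w n i - j%:R / K.+1%:R))).
by under eq_bigr => i _ do rewrite bE; rewrite prodr_const card_ord.
Qed.

(** Half of the Weyl criterion, in a quantitative form with grid points in
    place of an integral. The products of kernels centred at the points of the
    grid of step 1 / (K + 1) add up to the constant B. If X n holds, the
    points outside Y are far from w n, and together contribute at most (K +
    1)^(d + 1) times an exponentially small number; so the sum over Y, divided
    by B, majorizes the indicator of X up to e / 2, and its mean is the
    proportion of Y. Lower bounds follow by applying this to complements. *)
Lemma freq_le_grid (delta e : R) : 0 < delta -> delta < 2^-1 -> 0 < e ->
  \forall K \near \oo, forall (X : pred nat) (Y : {set {ffun 'I_d.+1 -> 'I_K.+1}}),
  (forall n (p : {ffun 'I_d.+1 -> 'I_K.+1}), X n ->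
     (forall i, exists m : int, `|w n i - (p i)%:R / K.+1%:R - m%:~R| < delta) -> p \in Y) ->
  \forall N \near \oo,
    (\sum_(n < N) (X n)%:R) / N%:R <= #|Y|%:R / K.+1%:R ^+ d.+1 + e.
Proof.
move=> delta0 delta2 e0; pose rho : R := (1 + cos (2 * pi * delta)) / 2.
have rho01 : 0 <= rho < 1.
  by rewrite kernel_lt1// andbT; case/andP: (kernel_base delta).
have := natr_exp_cvg0 d.+1 rho01.
have c0 : 0 < e / 2 / 2 ^+ d.+1 by rewrite !divr_gt0 ?exprn_gt0.
move=> /cvgr0Pnorm_le /(_ _ c0) tail0.
near=> K => X Y XY.
have [b [bE newton_sum b1]] := kernel_expansion R K.
set L := K.+1%:R in newton_sum b1 XY *.
pose B := (L * b 0%N) ^+ d.+1.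
have B1 : 1 <= B by exact: exprn_ege1.
have B0 : 0 < B := lt_le_trans ltr01 B1.
have L0 : 0 < L by rewrite ltr0n.
have tail : L ^+ d.+1 * kernel K delta <= e / 2.
  have : `|K%:R ^+ d.+1 * rho ^+ K| <= e / 2 / 2 ^+ d.+1 by near: K.
  rewrite ger0_norm ?mulr_ge0 ?exprn_ge0//; last by case/andP: rho01.
  rewrite ler_pdivlMr ?exprn_gt0// => h.
  apply: le_trans h; rewrite mulrAC -exprMn ler_wpM2r//; first exact: kernel_ge0.
  have K1 : 1 <= K%:R :> R by rewrite ler1n; near: K; exact: nbhs_infty_gt.
  by rewrite lerXn2r ?nnegrE ?mulr_ge0 ?(ltW L0)// /L -[K.+1%:R]natr1; lra.
pose u n := B^-1 * \sum_(p in Y) kernel_prod K (fun i => p i) n + e / 2.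
have hu : has_mean u (#|Y|%:R / L ^+ d.+1 + e / 2).
  apply: has_meanD; last exact: has_mean_cst.
  rewrite (_ : _ / _ = B^-1 * \sum_(p <- enum Y) b 0%N ^+ d.+1); last first.
    have b0 : b 0%N != 0.
      by apply: contraTneq b1 => ->; rewrite mulr0 ler10.
    rewrite big_enum sumr_const -[X in _ = _ * X]mulr_natl /B exprMn invfM mulrACA.
    by rewrite mulVf ?expf_neq0// mulr1 mulrC.
  apply: has_meanZ; apply: has_mean_ext (@has_mean_sum _ _ (enum Y) _ _
    (fun p => @has_mean_kernel_prod K b (fun i => p i) bE)) => n.
  by rewrite big_enum.
have Xu n : (X n)%:R <= u n.
  have kp0 p : 0 <= kernel_prod K p n.
    by apply: prodr_ge0 => i _; exact: kernel_ge0.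
  case: (boolP (X n)) => [Xn|_]; last first.
    rewrite addr_ge0 ?mulr_ge0 ?invr_ge0 ?(ltW B0) ?sumr_ge0// ?divr_ge0 ?ltW//.
  have := @sum_kernel_prod K _ n newton_sum; rewrite -/L -/B (bigID (mem Y))/=.
  set S1 := \sum_(p in Y) _; set S2 := \sum_(p | _) _ => SB.
  have S2e : S2 <= e / 2.
    apply: le_trans tail; rewrite /S2.
    apply: le_trans (_ : \sum_(p : {ffun 'I_d.+1 -> 'I_K.+1}) kernel K delta <= _); last first.
      by rewrite sumr_const card_ffun !card_ord -[leLHS]mulr_natl natrX.
    rewrite [leRHS](bigID (mem Y))/= -[leLHS]add0r lerD ?sumr_ge0// => [p _|].
      exact: kernel_ge0.
    apply: ler_sum => p pY.
    have [i hi] : exists i, forall m : int, delta <= `|w n i - (p i)%:R / L - m%:~R|.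
      apply: contrapT => /forallNP no; move/negP: pY; apply; apply: (XY n) => // i.
      have /existsNP[m hm] := no i; exists m; rewrite ltNge; exact/negP.
    rewrite /kernel_prod (bigD1 i)//= -[leRHS]mulr1 ler_pM ?kernel_ge0//.
    - by apply: prodr_ge0 => j _; exact: kernel_ge0.
    - exact: kernel_tail.
    - by apply: prodr_ile1 => j _; rewrite kernel_ge0 kernel_le1.
  have S20 : 0 <= S2 by apply: sumr_ge0.
  have : B^-1 * S2 <= S2 by rewrite ler_piMl// invf_le1.
  have : B^-1 * (S1 + S2) = 1 by rewrite SB mulVf// gt_eqF.
  rewrite mulrDr /u -/S1; move: (B^-1 * S1) (B^-1 * S2) => x y; lra.
have e2 : 0 < e / 2 by rewrite divr_gt0.
move/cvgrPdist_le : hu => /(_ _ e2); apply: filterS => N.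
set a := _ / L ^+ _; set v := (\sum_(n < N) u n) / N%:R.
have : (\sum_(n < N) (X n)%:R) / N%:R <= v.
  by rewrite /v ler_wpM2r ?invr_ge0//; apply: ler_sum => n _.
by move: v => v; rewrite ler_norml; lra.
Unshelve. all: by end_near. Qed.

End weyl_criterion.

(** * Finite differences and extrapolation *)

Section differences.
Variable V : zmodType.
Implicit Types (a b c : nat -> V).

Definition diff a n := a n.+1 - a n.

Definition newton_sum m c (j : nat) : V := \sum_(i < m) c i *+ 'C(j, i).

(** The polynomial of degree at most d through the first d + 1 values of a, in
    Newton's form. *)
Definition extrap d a := newton_sum d.+1 (fun i => iter i diff a 0%N).

Lemma iter_diff_ext i a b n : (forall l, (l <= i)%N -> a (n + l)%N = b (n + l)%N) ->
  iter i diff a n = iter i diff b n.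
Proof.
elim: i n => [|i ih] n ab; first by have := ab 0%N; rewrite addn0; exact.
rewrite /= /diff ih => [|l li]; first rewrite ih// => l li.
  by apply: ab; exact: leqW.
by rewrite addSnnS; exact: ab.
Qed.

Lemma iter_diffD i a b n :
  iter i diff (fun l => a l + b l) n = iter i diff a n + iter i diff b n.
Proof.
elim: i n => [|i ih] n //=.
by rewrite /diff !ih opprD addrACA.
Qed.

(** Induction on j by Pascal's rule; the summation bound m stays the same
    along the induction, as the binomials vanish beyond j. *)
Lemma newton_expansion a n m j : (j < m)%N ->
  a (n + j)%N = newton_sum m (fun i => iter i diff a n) j.
Proof.
elim: j n m => [|j ih] n [|m]// jm.
  rewrite /newton_sum big_ord_recl big1 ?addn0 ?addr0//.
rewrite -addSnnS (ih _ m.+1) ?(ltnW jm)// /newton_sum.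
under eq_bigr => i _.
  rewrite (_ : iter i diff a n.+1 = iter i diff a n + iter i.+1 diff a n); last first.
    by rewrite /= /diff addrC subrK.
  rewrite mulrnDl; over.
rewrite big_split /= [X in _ + X]big_ord_recr /= bin_small// mulr0n addr0.
rewrite big_ord_recl [RHS]big_ord_recl !bin0 -addrA; congr (_ + _).
rewrite -big_split; apply: eq_bigr => i _.
by rewrite lift0 binS mulrnDr.
Qed.

Lemma diff_newton_sum m c : diff (newton_sum m.+1 c) =1 newton_sum m (fun i => c i.+1).
Proof.
move=> j; rewrite /diff /newton_sum -sumrB big_ord_recl !bin0 subrr add0r.
by apply: eq_bigr => i _; rewrite lift0 binS mulrnDr addrAC subrr add0r.
Qed.

Lemma iter_diff_newton_sum l m c :
  iter l diff (newton_sum (m + l) c) =1 newton_sum m (fun i => c (i + l)%N).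
Proof.
elim: l m => [|l ih] m j; first by rewrite addn0; apply: eq_bigr => i _; rewrite addn0.
rewrite /= addnS -addSn /diff !ih -[LHS]/(diff _ _) diff_newton_sum.
by apply: eq_bigr => i _; rewrite addSnnS.
Qed.

Lemma iter_diff_newton_sum0 l m c : (l < m)%N -> iter l diff (newton_sum m c) 0%N = c l.
Proof.
move=> lm; rewrite -(subnK (ltnW lm)) iter_diff_newton_sum /newton_sum.
have : (0 < m - l)%N by rewrite subn_gt0.
case: (m - l)%N => // k _; rewrite big_ord_recl add0n big1 ?addr0//.
Qed.

Lemma extrap_id d a j : (j <= d)%N -> extrap d a j = a j.
Proof. by move=> jd; rewrite -[a j]/(a (0 + j)%N) (@newton_expansion _ _ d.+1). Qed.

Lemma extrap_ext d a b : (forall i, (i <= d)%N -> a i = b i) -> extrap d a =1 extrap d b.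
Proof.
move=> ab j; apply: eq_bigr => i _; congr (_ *+ _); apply: iter_diff_ext => l li.
by rewrite add0n ab// (leq_trans li)// -ltnS.
Qed.

Lemma extrapD d a b j : extrap d (fun i => a i + b i) j = extrap d a j + extrap d b j.
Proof.
by rewrite -big_split; apply: eq_bigr => i _; rewrite iter_diffD mulrnDl.
Qed.

Lemma extrap_cst d x j : extrap d (fun=> x) j = x.
Proof.
have cst0 l n : iter l.+1 diff (fun=> x) n = 0.
  by elim: l n => [|l ih] n; [rewrite /= /diff subrr|rewrite iterS /diff !ih subrr].
rewrite /extrap /newton_sum big_ord_recl bin0 big1 ?addr0// => i _.
by rewrite lift0 cst0 mul0rn.
Qed.

Lemma extrap_newton_sum d c : extrap d (newton_sum d.+1 c) =1 newton_sum d.+1 c.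
Proof. by move=> j; apply: eq_bigr => i _; rewrite iter_diff_newton_sum0. Qed.

(** A constant d-th difference makes all higher differences vanish in Newton's
    formula; conversely the d-th difference of a Newton sum of degree d is its
    last coefficient. *)
Lemma constant_diffP (k d : nat) a : (d < k)%N ->
  (forall m n, (m < k - d)%N -> (n < k - d)%N -> iter d diff a m = iter d diff a n) <->
  (forall j, (j < k)%N -> a j = extrap d a j).
Proof.
move=> dk; split => [cst j jk|ae m n mk nk].
  have vanish t n : (n + d + t.+1 < k)%N -> iter (d + t.+1) diff a n = 0.
    elim: t n => [|t ih] n nk.
      rewrite addn1 /= /diff (cst n.+1 n) ?subrr//; lia.
    rewrite addnS /= /diff !ih ?subrr//; lia.
  rewrite -[a j]/(a (0 + j)%N) (@newton_expansion _ _ (d.+1 + j)); last first.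
    by rewrite addSn ltnS leq_addl.
  rewrite /newton_sum big_split_ord -[RHS]addr0; congr (_ + _); apply: big1 => i _.
  have -> : nat_of_ord (rshift d.+1 i) = (d + i.+1)%N by rewrite /= addSnnS.
  have [dij|dij] := leqP (d + i.+1) j; last by rewrite bin_small.
  by rewrite vanish ?mul0rn// add0n; lia.
have ext l : (l < k - d)%N -> iter d diff a l = iter d diff a 0%N.
  move=> lk.
  rewrite (@iter_diff_ext d a (extrap d a)); last by move=> t td; rewrite ae//; lia.
  rewrite /extrap -[d.+1]add1n iter_diff_newton_sum /newton_sum big_ord1 bin0.
  by rewrite add0n.
by rewrite (ext m)// (ext n).
Qed.

End differences.

Lemma iter_diff_raddf (U V : zmodType) (g : {additive U -> V}) i (a : nat -> U) n :
  iter i (@diff V) (g \o a) n = g (iter i (@diff U) a n).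
Proof. by elim: i n => [|i ih] n //=; rewrite /diff !ih raddfB. Qed.

Lemma extrap_raddf (U V : zmodType) (g : {additive U -> V}) d (a : nat -> U) j :
  extrap d (g \o a) j = g (extrap d a j).
Proof.
by rewrite raddf_sum; apply: eq_bigr => i _; rewrite iter_diff_raddf raddfMn.
Qed.

Section extrap_real.
Variable R : realType.

(** A Lipschitz constant, for the sup norm, of the extrapolation to all the
    indices below k. *)
Definition extrap_lip_const (k d : nat) : nat := \sum_(j < k) \sum_(i < d.+1) 2 ^ i * 'C(j, i).

Lemma iter_diff_bound (a : nat -> R) (e : R) i n :
  (forall l, (l <= i)%N -> `|a (n + l)%N| <= e) -> `|iter i (@diff R) a n| <= 2 ^+ i * e.
Proof.
elim: i n => [|i ih] n ae; first by have := ae 0%N; rewrite addn0 mul1r; exact.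
rewrite /= /diff (le_trans (ler_normB _ _))// exprS -mulrA mulr_natl mulr2n lerD//.
  by apply: ih => l li; rewrite addSnnS ae.
by apply: ih => l li; rewrite ae// leqW.
Qed.

Lemma extrap_lip k d (a : nat -> R) (e : R) j : (j < k)%N ->
  (forall i, (i <= d)%N -> `|a i| <= e) -> `|extrap d a j| <= (extrap_lip_const k d)%:R * e.
Proof.
move=> jk ae; have e0 : 0 <= e by exact: le_trans (ae 0%N _).
apply: (@le_trans _ _ ((\sum_(i < d.+1) 2 ^ i * 'C(j, i))%N%:R * e)).
  rewrite natr_sum mulr_suml (le_trans (ler_norm_sum _ _ _))// ler_sum// => i _.
  rewrite normrMn -[leLHS]mulr_natr natrM natrX mulrAC ler_wpM2r//.
  by apply: iter_diff_bound => l li; rewrite ae// (leq_trans li)// -ltnS.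
rewrite ler_wpM2r// ler_nat /extrap_lip_const (bigD1 (Ordinal jk))//=; exact: leq_addr.
Qed.

(** Extrapolation has integer coefficients, so it commutes with subtracting
    the integer parts: x j minus the extrapolated floors is the extrapolation
    of the fractional parts plus the error of extrapolating x itself. *)
Lemma floor_extrapP k d (x : nat -> R) :
  (forall j, (j < k)%N -> Num.floor (x j) = extrap d (fun i => Num.floor (x i)) j) <->
  (forall j, (j < k)%N -> 0 <= extrap d (fun i => x i - (Num.floor (x i))%:~R) j
                           + (x j - extrap d x j) < 1).
Proof.
have xE j : extrap d (fun i => x i - (Num.floor (x i))%:~R) j + (x j - extrap d x j) =
    x j - (extrap d (fun i => Num.floor (x i)) j)%:~R.
  have -> : extrap d x j = extrap d (fun i => x i - (Num.floor (x i))%:~R) j +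
      extrap d (fun i => (Num.floor (x i))%:~R) j.
    by rewrite -extrapD; apply: extrap_ext => i _; rewrite subrK.
  rewrite (extrap_raddf (intr : {additive int -> R}) d (fun i => Num.floor (x i))) /=.
  by ring.
have eq j : (Num.floor (x j) == extrap d (fun i => Num.floor (x i)) j) =
    (0 <= x j - (extrap d (fun i => Num.floor (x i)) j)%:~R < 1).
  by rewrite floor_eq intrD1 subr_ge0 ltrBlDl.
by split => h j jk; [rewrite xE -eq; apply/eqP/h|apply/eqP; rewrite eq -xE; exact: h].
Qed.

End extrap_real.

(** * Grid points near a vector of fractional parts *)

(** The lattice points of the dilated polytope, parametrized by the first d +
    1 values of the extrapolated sequence rather than by its differences. In
    these coordinates the points of a grid of the torus are the tuples of
    numbers below the grid size. *)
Definition lattice_set k d n : {set {ffun 'I_d.+1 -> 'I_n}} :=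
  [set u : {ffun 'I_d.+1 -> 'I_n} |
    [forall j : 'I_k, 0 <= extrap d (fun i => (u (inord i))%:Z) j < n%:Z]].

Section density.
Variables (R : realType) (k d : nat).
Hypothesis dk : (d < k)%N.

Lemma extrap_shift (z : nat -> int) (A : int) j :
  extrap d (fun i => z i + A) j = extrap d z j + A.
Proof. by rewrite extrapD extrap_cst. Qed.

Lemma extrap_natdiv (z : nat -> int) (L : R) j :
  extrap d (fun i => (z i)%:~R / L) j = (extrap d z j)%:~R / L.
Proof.
exact: (extrap_raddf (GRing.mulr_fun L^-1 intr : {additive int -> R}) d z j).
Qed.

Section bounds.
Variables (s A K : nat).
Hypotheses (s4 : (4 <= s)%N) (A0 : (0 < A)%N) (KsA : K.+1 = (s * A)%N).

(** The tolerance delta is such that perturbing d + 1 values by delta moves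
    the extrapolated values by less than 1 / s, that is, by less than A steps
    of the grid of size s A. *)
Let delta : R := (s%:R * (extrap_lip_const k d + 2)%:R)^-1.
Let L : R := K.+1%:R.

Let L0 : 0 < L. Proof. by rewrite ltr0n. Qed.

Let s0 : 0 < s%:R :> R. Proof. by rewrite ltr0n (leq_trans _ s4). Qed.

Let c0 : 0 < (extrap_lip_const k d + 2)%:R :> R. Proof. by rewrite ltr0n addn2. Qed.

Lemma delta_gt0 : 0 < delta.
Proof. by rewrite invr_gt0 mulr_gt0. Qed.

Lemma delta_lt_half : delta < 2^-1.
Proof.
rewrite /delta ltf_pV2 ?posrE ?mulr_gt0//.
rewrite -natrM ltr_nat; apply: (@leq_trans (4 * 2)) => //.
by apply: leq_mul => //; rewrite leq_addl.
Qed.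

Lemma lip_delta : ((extrap_lip_const k d)%:R + 1) * delta * L < A%:R.
Proof.
rewrite /L KsA natrM /delta invfM.
have -> : ((extrap_lip_const k d)%:R + 1) *
    (s%:R^-1 * (extrap_lip_const k d + 2)%:R^-1) * (s%:R * A%:R) =
  ((extrap_lip_const k d)%:R + 1) / (extrap_lip_const k d + 2)%:R * A%:R :> R.
  by field; rewrite !gt_eqF.
rewrite -[ltRHS]mul1r ltr_pM2r ?ltr0n// ltr_pdivrMr//.
by rewrite mul1r natr1 ltr_nat addn2.
Qed.

Let fr (x : nat -> R) i := x i - (Num.floor (x i))%:~R.

(** Lifting p to the grid point nearest to the vector of fractional parts
    gives an integer sequence whose extrapolation stays in [-A, K + 1 + A[.
    Translating by the constant sequence A, which extrapolation preserves,
    moves it into a lattice set; the translation is undone modulo the grid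
    size. *)
Lemma good_near_grid (x : nat -> R) (p : {ffun 'I_d.+1 -> 'I_K.+1}) :
  (forall j, (j < k)%N -> 0 <= extrap d (fr x) j + (x j - extrap d x j) < 1) ->
  (forall j, (j < k)%N -> `|x j - extrap d x j| <= delta) ->
  (forall i : 'I_d.+1, exists m : int, `|x i - (p i)%:R / L - m%:~R| < delta) ->
  exists2 u, u \in lattice_set k d (K.+1 + A.*2) &
    p = [ffun i => inord ((u i + (K.+1 - A)) %% K.+1)].
Proof.
move=> good err /choice[M hM].
pose z (i : nat) : int := (p (inord i))%:Z + K.+1%:Z * (M (inord i) - Num.floor (x i)).
pose eta (i : nat) : R := x i - (p (inord i))%:R / L - (M (inord i))%:~R.
have zE i : (z i)%:~R / L = fr x i - eta i.
  rewrite /z /fr /eta rmorphD rmorphM rmorphB /= -!pmulrn -/L.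
  by field; rewrite gt_eqF.
have eta_le i : (i <= d)%N -> `|eta i| <= delta.
  move=> id; have := hM (inord i); rewrite inordK// => /ltW; exact.
have zb j : (j < k)%N -> - A%:Z <= extrap d z j < (K.+1 + A)%N%:Z.
  move=> jk.
  have e1 : (extrap d z j)%:~R / L = extrap d (fr x) j - extrap d eta j.
    rewrite -extrap_natdiv (@extrap_ext _ _ (fun i => (z i)%:~R / L) (fun i => fr x i - eta i))//.
    rewrite extrapD; congr (_ + _).
    exact: (extrap_raddf (-%R : {additive R -> R})).
  have h1 := good j jk; have h2 := err j jk.
  have h3 := extrap_lip jk eta_le.
  have h4 := lip_delta.
  have e2 : (extrap d z j)%:~R = (extrap d (fr x) j - extrap d eta j) * L.
    by rewrite -e1 mulfVK// gt_eqF.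
  have h5 : - ((extrap_lip_const k d)%:R + 1) * delta <= extrap d (fr x) j - extrap d eta j.
    move: h1 h2 h3; rewrite !ler_norml; lra.
  have h6 : extrap d (fr x) j - extrap d eta j <= 1 + ((extrap_lip_const k d)%:R + 1) * delta.
    move: h1 h2 h3; rewrite !ler_norml; lra.
  rewrite -(ler_int R) -(ltr_int R) e2 rmorphN /= -!pmulrn natrD -/L.
  have := ler_wpM2r (ltW L0) h5; have := ler_wpM2r (ltW L0) h6; move: h4; lra.
have zb' i : (i <= d)%N -> - A%:Z <= z i < (K.+1 + A)%N%:Z.
  by move=> id; rewrite -(extrap_id z id) zb// (leq_ltn_trans id).
pose u : {ffun 'I_d.+1 -> 'I_(K.+1 + A.*2)} := 
    [ffun i : 'I_d.+1 => inord (absz (z i + A%:Z)) : 'I_(K + A.*2).+1].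
have uE (i : 'I_d.+1) : (u i)%:Z = z i + A%:Z.
  have := zb' i (ltn_ord i); rewrite ffunE => zi.
  have h : (absz (z i + A%:Z)%R < (K + A.*2).+1)%N by lia.
  by rewrite (inordK h) gez0_abs//; lia.
exists u.
  rewrite inE; apply/forallP => j.
  have -> : extrap d (fun i => (u (inord i))%:Z) j = extrap d z j + A%:Z.
    rewrite -extrap_shift; apply: extrap_ext => i id.
    by rewrite uE inordK.
  by have := zb _ (ltn_ord j); move: (extrap d z j) => e; rewrite -addnn !PoszD; lia.
apply/ffunP => i; rewrite ffunE; apply/val_inj; rewrite /= inordK ?ltn_pmod//.
have AK : (A <= K.+1)%N by rewrite KsA leq_pmull//; lia.
have := uE i; rewrite /z inord_val => ui.
rewrite -[LHS](@modn_small _ K.+1)//; apply/eqP.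
rewrite -eqz_nat -!modz_nat PoszD ui -subzn//.
rewrite (_ : _ + _ = (M i - Num.floor (x i) + 1) * K.+1%:Z + (p i)%:Z); last by ring.
by rewrite modzMDl.
Qed.

(** Conversely a margin of A grid steps absorbs the tolerance, and no
    reduction modulo 1 occurs, since the fractional parts themselves stay away
    from 0 and 1. *)
Lemma grid_near_good (x : nat -> R) (u : {ffun 'I_d.+1 -> 'I_((s - 2) * A)})
    (p : {ffun 'I_d.+1 -> 'I_K.+1}) :
  u \in lattice_set k d ((s - 2) * A) -> (forall i, p i = (u i + A)%N :> nat) ->
  (forall j, (j < k)%N -> `|x j - extrap d x j| <= delta) ->
  (forall i : 'I_d.+1, exists m : int, `|x i - (p i)%:R / L - m%:~R| < delta) ->
  forall j, (j < k)%N -> 0 <= extrap d (fr x) j + (x j - extrap d x j) < 1.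
Proof.
rewrite inE => /forallP uL pu err /choice[M hM].
pose z (i : nat) : int := (p (inord i))%:Z.
pose eta (i : nat) : R := x i - (p (inord i))%:R / L - (M (inord i))%:~R.
have lip0 : 0 <= (extrap_lip_const k d)%:R :> R by [].
have lipd : ((extrap_lip_const k d)%:R + 1) * delta < s%:R^-1.
  have := lip_delta; rewrite /L KsA natrM mulrA gtr_pMl ?ltr0n//.
  by rewrite -ltr_pdivlMr// mul1r.
have delta_s : delta < s%:R^-1.
  apply: le_lt_trans lipd; rewrite mulrDl mul1r lerDr mulr_ge0// ltW//.
  exact: delta_gt0.
have AL : A%:R / L = s%:R^-1 by rewrite /L KsA natrM invfM mulrCA divff ?mulr1// pnatr_eq0; lia.
have fromz (a : int) : A%:Z <= a -> a < (K.+1 - A)%N%:Z -> s%:R^-1 <= a%:~R / L <= 1 - s%:R^-1.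
  have AK : (A <= K.+1)%N by rewrite KsA leq_pmull//; lia.
  have e1 : 1 - s%:R^-1 = (L - A%:R) / L by rewrite -AL mulrBl divff// lt0r_neq0.
  move=> a1 a2; rewrite e1 -AL !ler_pM2r ?invr_gt0//.
  rewrite pmulrn ler_int a1 /= /L !pmulrn -rmorphB /= ler_int; lia.
have zi i : (i <= d)%N -> s%:R^-1 <= (z i)%:~R / L <= 1 - s%:R^-1.
  move=> id; have := ltn_ord (u (inord i)); rewrite /z pu => h.
  by apply: fromz; rewrite ?KsA; lia.
have zE i : (i <= d)%N -> fr x i = (z i)%:~R / L + eta i.
  move=> id; have := hM (inord i); rewrite inordK// -/(eta i) => etai.
  rewrite /fr (_ : Num.floor (x i) = M (inord i)); last first.
    apply: floor_def; have := zi i id; move: etai.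
    have -> : x i = (z i)%:~R / L + eta i + (M (inord i))%:~R.
      by rewrite /eta /z -pmulrn; ring.
    move: ((z i)%:~R / L) (eta i) => a b; rewrite ltr_norml intrD1; lra.
  by rewrite /eta /z -pmulrn; ring.
have eta_le i : (i <= d)%N -> `|eta i| <= delta.
  by move=> id; have := hM (inord i); rewrite inordK// => /ltW; exact.
move=> j jk.
have h1 : s%:R^-1 <= (extrap d z j)%:~R / L <= 1 - s%:R^-1.
  have zu : extrap d z j = extrap d (fun i => (u (inord i))%:Z) j + A%:Z.
    by rewrite -extrap_shift; apply: extrap_ext => i id; rewrite /z pu PoszD.
  have := uL (Ordinal jk); rewrite /= => h.
  by apply: fromz; rewrite zu ?KsA; move: (extrap d _ j) h => e; lia.
rewrite (@extrap_ext _ _ (fr x) (fun i => (z i)%:~R / L + eta i)); last exact: zE.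
rewrite extrapD extrap_natdiv.
have h2 := err j jk; have h3 := extrap_lip jk eta_le.
move: h1 h2 h3; rewrite !ler_norml; move: (_ / L) => a; lra.
Qed.

End bounds.
End density.

(** * Density of polynomial rounding patterns *)

Lemma ltn_add_mul u s A : (2 <= s)%N -> (u < (s - 2) * A)%N -> (u + A < s * A)%N.
Proof. by move=> s2 uA; rewrite -[s in (_ < s * _)%N](subnK s2) mulnDl mul2n -addnn; lia. Qed.

Lemma mul_subn2 s A c : (3 <= s)%N -> (c <= A)%N ->
  ((s - 2) * A = ((s - 3) * A + (A - c)) + c)%N.
Proof.
move=> s3 cA; rewrite -addnA subnK//.
by rewrite (_ : (s - 2 = (s - 3).+1)%N) ?mulSnr//; lia.
Qed.

Section density.
Variables (R : realType) (k d : nat) (x : nat -> nat -> R) (V : R) (c : nat) (G : pred nat).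
Hypothesis dk : (d < k)%N.
Hypothesis weyl : forall h : 'I_d.+1 -> int, (exists i, h i != 0) ->
  forall t, has_mean (fun n => cos (2 * pi * (\sum_i (h i)%:~R * x n i) + t)) 0.
Hypothesis err0 : forall j, (j < k)%N -> x n j - extrap d (x n) j @[n --> \oo] --> 0.
Hypothesis card_le_volume : forall m, #|lattice_set k d m|%:R <= V * (m + c)%:R ^+ d.+1.
Hypothesis volume_le_card : forall m, V * m%:R ^+ d.+1 <= #|lattice_set k d (m + c)|%:R.
Hypothesis GP : forall n, G n <-> forall j, (j < k)%N ->
  0 <= extrap d (fun i => x n i - (Num.floor (x n i))%:~R) j + (x n j - extrap d (x n) j) < 1.

(** The frequency of G is squeezed between the numbers of points of two
    lattice sets, of sizes (s + 2) A and (s - 2) A, divided by the number (s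
    A)^(d + 1) of points of the grid. Both counts are estimated by V, so the
    frequency is within a factor (1 + 3 / s)^(d + 1) or (1 - 3 / s)^(d + 1) of
    V, and s is arbitrary. Enlarging or shrinking the window only changes the
    size of the lattice set, so no estimate on the boundary of the polytope
    enters. *)
Lemma lattice_density : has_mean (fun n => (G n)%:R) V.
Proof.
have V0 : 0 <= V.
  have h : 0 < (1 + c)%:R ^+ d.+1 :> R by rewrite exprn_gt0// ltr0n.
  by have := le_trans (ler0n R _) (card_le_volume 1); rewrite (pmulr_lge0 _ h).
apply/cvgrPdist_le => e e0; have e4 : 0 < e / 4 by rewrite divr_gt0.
have cvg_s (b : R) : (fun s : nat => V * (1 + b / s%:R) ^+ d.+1) @ \oo --> V.
  have h1 : (fun s : nat => 1 + b / s%:R) @ \oo --> (1 + 0 : R).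
    apply: cvgD; first exact: cvg_cst.
    by apply: cvg0Ml; rewrite -cvg_shiftS; exact: cvg_harmonic.
  have h2 : (fun s : nat => (1 + b / s%:R) ^+ d.+1) @ \oo --> ((1 + 0) ^+ d.+1 : R).
    exact: (cvg_comp _ (fun z : R => z ^+ d.+1) h1 (@exprn_continuous _ d.+1 _)).
  have : (fun s : nat => V * (1 + b / s%:R) ^+ d.+1) @ \oo --> (V * (1 + 0) ^+ d.+1 : R).
    exact: cvgMl_tmp.
  by rewrite addr0 expr1n mulr1.
have [s [s4 sup slow]] : exists s, [/\ (4 <= s)%N, V * (1 + 3 / s%:R) ^+ d.+1 <= V + e / 4 &
    V - e / 4 <= V * (1 + (- 3) / s%:R) ^+ d.+1].
  have /cvgrPdist_le/(_ _ e4) h1 := cvg_s 3.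
  have /cvgrPdist_le/(_ _ e4) h2 := cvg_s (- 3).
  have [s _ hs] : \forall s \near \oo, [/\ (4 <= s)%N, V * (1 + 3 / s%:R) ^+ d.+1 <= V + e / 4 &
      V - e / 4 <= V * (1 + (- 3) / s%:R) ^+ d.+1].
    near=> s.
    have a1 : `|V - V * (1 + 3 / s%:R) ^+ d.+1| <= e / 4 by near: s.
    have a2 : `|V - V * (1 + (- 3) / s%:R) ^+ d.+1| <= e / 4 by near: s.
    split; first by near: s; exact: nbhs_infty_ge.
    - by move: a1; move: (V * _) => ?; rewrite ler_norml; lra.
    - by move: a2; move: (V * _) => ?; rewrite ler_norml; lra.
  by exists s; apply: hs => /=.
pose delta : R := (s%:R * (extrap_lip_const k d + 2)%:R)^-1.
have delta0 : 0 < delta by exact: (delta_gt0 R k d s4).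
have delta2 : delta < 2^-1 by exact: (delta_lt_half R k d s4).
have [K0 _ hK0] := @freq_le_grid R d (fun n (i : 'I_d.+1) => x n i) weyl
  delta (e / 4) delta0 delta2 e4.
(* The grid has s A points per side: K is large enough for the frequency
   bound, and A exceeds the rounding constant c. *)
pose A := (K0 + c).+1; pose K := (s * A).-1.
have A0 : (0 < A)%N by [].
have cA : (c <= A)%N by rewrite ltnW// ltnS leq_addl.
have KsA : K.+1 = (s * A)%N by rewrite prednK// muln_gt0 A0 (leq_trans _ s4).
have KK0 : (K0 <= K)%N.
  rewrite -ltnS KsA (@leq_trans A) ?ltnS ?leq_addr//.
  by rewrite leq_pmull// (leq_trans _ s4).
have freq := hK0 K KK0; rewrite /= in freq.
pose err n := `[< forall j, (j < k)%N -> `|x n j - extrap d (x n) j| <= delta >].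
have errP : \forall n \near \oo, err n.
  have : \forall n \near \oo, forall j : 'I_k, `|x n j - extrap d (x n) j| <= delta.
    apply: filter_forall => j.
    by have /cvgr0Pnorm_le/(_ _ delta0) := err0 (ltn_ord j).
  by apply: filterS => n h; apply/asboolP => j jk; exact: h (Ordinal jk).
have L0 : 0 < K.+1%:R :> R by [].
have Lq0 : 0 < K.+1%:R ^+ d.+1 :> R by rewrite exprn_gt0.
have s0 : 0 < s%:R :> R by rewrite ltr0n (leq_trans _ s4).
have sA (m : nat) : (m * A)%:R / K.+1%:R = m%:R / s%:R :> R.
  by rewrite KsA !natrM; field; rewrite lt0r_neq0 ?lt0r_neq0//.
pose rho (u : {ffun 'I_d.+1 -> 'I_(K.+1 + A.*2)}) : {ffun 'I_d.+1 -> 'I_K.+1} :=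
  [ffun i => inord ((u i + (K.+1 - A)) %% K.+1)].
have := freq (fun n => G n && err n) (rho @: lattice_set k d (K.+1 + A.*2)).
case=> [n p /andP[/GP gn /asboolP en] np|N1 _ hN1].
  have [u uL ->] := good_near_grid dk s4 A0 KsA gn en np.
  by apply/imsetP; exists u.
have upper : (#|rho @: lattice_set k d (K.+1 + A.*2)|%:R / K.+1%:R ^+ d.+1) <= V + e / 4.
  apply: le_trans sup; rewrite ler_pdivrMr//.
  apply: (@le_trans _ _ (#|lattice_set k d (K.+1 + A.*2)|%:R)).
    by rewrite ler_nat leq_imset_card.
  apply: le_trans (card_le_volume _) _; rewrite -mulrA ler_wpM2l// -exprMn.
  have -> : (1 + 3 / s%:R) * K.+1%:R = ((s + 3) * A)%:R :> R.
    rewrite -[RHS](divfK (lt0r_neq0 L0)) sA; congr (_ * _).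
    by rewrite (natrD _ s 3); field; exact: lt0r_neq0.
  by rewrite lerXn2r ?nnegrE// ler_nat KsA mulnDl -addnA leq_add2l mulSnr mul2n leq_add2l.
pose sig (u : {ffun 'I_d.+1 -> 'I_((s - 2) * A)}) : {ffun 'I_d.+1 -> 'I_K.+1} :=
  [ffun i => inord (u i + A)].
have sigE u i : sig u i = (u i + A)%N :> nat.
  by rewrite ffunE inordK// KsA ltn_add_mul// (leq_trans _ s4).
have sig_inj : injective sig.
  move=> u v uv; apply/ffunP => i; apply/val_inj/eqP.
  by rewrite -(eqn_add2r A) -!sigE uv.
have := freq (fun n => ~~ G n && err n) (~: (sig @: lattice_set k d ((s - 2) * A))).
case=> [n p /andP[/negP gn /asboolP en] np|N2 _ hN2].
  rewrite inE; apply/imsetP => -[u uL pu]; apply: gn; apply/GP.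
  apply: (grid_near_good dk s4 A0 KsA uL _ en np) => i.
  by rewrite pu sigE.
have lower : V - e / 4 <= 1 - #|~: (sig @: lattice_set k d ((s - 2) * A))|%:R / K.+1%:R ^+ d.+1.
  apply: (le_trans slow).
  have -> : #|~: (sig @: lattice_set k d ((s - 2) * A))|%:R =
      K.+1%:R ^+ d.+1 - #|lattice_set k d ((s - 2) * A)|%:R :> R.
    have := cardsC (sig @: lattice_set k d ((s - 2) * A)).
    rewrite card_ffun !card_ord card_imset// => /(congr1 (fun m => m%:R : R)).
    by rewrite natrD natrX => <-; rewrite addrC addKr.
  rewrite mulrBl divff ?lt0r_neq0// subKr ler_pdivlMr//.
  have := volume_le_card ((s - 3) * A + (A - c)); rewrite -(mul_subn2 (ltnW s4) cA).
  apply: le_trans; rewrite -mulrA ler_wpM2l// -exprMn.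
  have -> : (1 + (- 3) / s%:R) * K.+1%:R = ((s - 3) * A)%:R :> R.
    rewrite -[RHS](divfK (lt0r_neq0 L0)) sA; congr (_ * _).
    by rewrite (natrB _ (ltnW s4)); field; exact: lt0r_neq0.
  by rewrite lerXn2r ?nnegrE// ler_nat leq_addr.
have d1 : has_mean (fun n => (G n)%:R - (G n && err n)%:R) (0 : R).
  apply: has_mean_cvg; apply: cvg_near_cst; apply: filterS errP => n ->.
  by rewrite andbT subrr.
have d2 : has_mean (fun n => (G n)%:R + (~~ G n && err n)%:R) (1 : R).
  apply: has_mean_cvg; apply: cvg_near_cst; apply: filterS errP => n ->.
  by rewrite andbT; case: (G n); rewrite /= ?addr0 ?add0r.
move/cvgr0Pnorm_le : d1 => /(_ _ e4) d1; move/cvgrPdist_le : d2 => /(_ _ e4) d2.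
near=> N.
have a1 : `|(\sum_(n < N) ((G n)%:R - (G n && err n)%:R)) / N%:R| <= e / 4 by near: N.
have a2 : `|1 - (\sum_(n < N) ((G n)%:R + (~~ G n && err n)%:R)) / N%:R| <= e / 4 by near: N.
have a3 : (\sum_(n < N) (G n && err n)%:R) / N%:R <= V + e / 4 + e / 4.
  by apply: (le_trans (hN1 N _)); [near: N; exact: nbhs_infty_ge|rewrite lerD2r].
have a4 : (\sum_(n < N) (~~ G n && err n)%:R) / N%:R <= 1 - (V - e / 4) + e / 4.
  by apply: (le_trans (hN2 N _)); [near: N; exact: nbhs_infty_ge|rewrite lerD2r lerBrDl -lerBrDr].
move: a1 a2 a3 a4; rewrite sumrB big_split /= mulrBl mulrDl.
move: (_ / N%:R) (_ / N%:R) (_ / N%:R) => p q r.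
by rewrite !ler_norml; lra.
Unshelve. all: by end_near. Qed.

End density.

(** * Grid cubes and the volume of the polytope *)

Section volume.
Variables (R : realType) (k d : nat).
Hypothesis dk : (d < k)%N.
Local Notation T := (measurableTypeR R).
Local Notation C := (@Ckd R k d).

Lemma CkdE : C = [set y | forall j : nat, (j < k)%N ->
  0 <= \sum_(i < d.+1) 'C(j, i)%:R * tnth y i < 1].
Proof.
have y0 (y : d.+1.-tuple R) : \sum_(i < d.+1) 'C(0, i)%:R * tnth y i = tnth y ord0.
  rewrite big_ord_recl mul1r big1 ?addr0// => i _; by rewrite bin0n mul0r.
apply/seteqP; split => y /=.
  by move=> [h0 h] [|j] jk; [rewrite y0|apply: h].
by move=> h; split => [|j /andP[_ jk]]; [rewrite -y0; apply: h; case: (k) dk|exact: h].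
Qed.

Lemma measurable_slab n (b : 'I_n -> R) (v : R) :
  measurable [set y : n.-tuple T | 0 <= v + \sum_(i < n) b i * tnth y i < 1].
Proof.
have mf : measurable_fun [set: n.-tuple T] (fun y => v + \sum_(i < n) b i * (tnth y i : R)).
  apply: measurable_funD => //; apply: measurable_sum => i.
  by apply: measurable_funM => //; exact: measurable_tnth.
have := mf measurableT _ (measurable_itv `[0, 1[).
by rewrite setTI; congr measurable; apply/seteqP; split => y /=; rewrite in_itv.
Qed.

Lemma measurable_Ckd : measurable (C : set (d.+1.-tuple T)).
Proof.
rewrite CkdE.
have -> : [set y | forall j : nat, (j < k)%N ->
    0 <= \sum_(i < d.+1) 'C(j, i)%:R * tnth y i < 1] =
  \bigcap_(j in `I_k) [set y : d.+1.-tuple T |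
    0 <= 0 + \sum_(i < d.+1) 'C(j, i)%:R * tnth y i < 1].
  by apply/seteqP; split => y h j jk; have /= := h j jk; rewrite /mkset add0r.
apply: fin_bigcap_measurable => [|j _]; first exact: finite_II.
exact: measurable_slab.
Qed.

Definition cube (L : R) (p : 'I_d.+1 -> int) : set (d.+1.-tuple T) :=
  box (fun i => `[(p i)%:~R / L, ((p i)%:~R + 1) / L[%classic).

Lemma measurable_cube L p : measurable (cube L p).
Proof. by apply: measurable_box => i; exact: measurable_itv. Qed.

Lemma lebesgue_cube (mu : {sigma_finite_measure set (d.+1.-tuple T) -> \bar R}) (L : R) p :
  0 < L -> (forall A : 'I_d.+1 -> set T, (forall i, measurable (A i)) ->
      mu (box A) = (\prod_(i < d.+1) lebesgue_measure (A i))%E) ->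
  mu (cube L p) = ((L ^- d.+1)%:E)%E.
Proof.
move=> L0 muE; rewrite muE => [|i]; last exact: measurable_itv.
rewrite (eq_bigr (fun=> (L^-1)%:E)) => [|i _].
  by rewrite prodEFin prodr_const card_ord exprVn.
rewrite lebesgue_measure_itv /= lte_fin ltr_pM2r ?invr_gt0// ltrDl ltr01.
by rewrite -EFinB mulrDl mul1r addrAC subrr add0r.
Qed.

(** The cubes tile the space: the corner of the cube of a point is its integer
    part at scale L. *)
Lemma in_cube (L : R) (p : 'I_d.+1 -> int) (y : d.+1.-tuple R) : 0 < L ->
  (y : d.+1.-tuple T) \in cube L p <-> forall i, p i = Num.floor (L * tnth y i).
Proof.
move=> L0; have e i : (p i == Num.floor (L * tnth y i)) =
    (tnth y i \in `[(p i)%:~R / L, ((p i)%:~R + 1) / L[).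
  rewrite eq_sym floor_eq in_itv /= intrD1 ler_pdivrMr// ltr_pdivlMr//.
  by rewrite mulrC.
rewrite inE; split => h i; first by apply/eqP; rewrite e; exact: h.
by have := e i; rewrite h eqxx => /esym.
Qed.

(** Rounding the coordinates down to the grid can only decrease the Newton
    sums, as the binomials are nonnegative, and by a bounded number of steps. *)
Lemma newton_sum_floor (y : d.+1.-tuple R) (L : R) (p : nat -> int) j : (j < k)%N ->
  (forall i : 'I_d.+1, p i = Num.floor (L * tnth y i)) ->
  (newton_sum d.+1 p j)%:~R <= L * \sum_(i < d.+1) 'C(j, i)%:R * tnth y i <
    (newton_sum d.+1 p j)%:~R + (extrap_lip_const k d)%:R + 1.
Proof.
move=> jk pE; rewrite mulr_sumr /newton_sum rmorph_sum /=.
have h (i : 'I_d.+1) : (p i *+ 'C(j, i))%:~R <= L * ('C(j, i)%:R * tnth y i) <=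
    (p i *+ 'C(j, i))%:~R + ((2 ^ i * 'C(j, i))%N%:R : R).
  have := floor_itv (L * tnth y i); rewrite -pE intrD1 => /andP[h1 h2].
  have c0 : 0 <= 'C(j, i)%:R :> R by [].
  rewrite rmorphMn /= -mulr_natl mulrCA ler_wpM2l//=.
  apply: (@le_trans _ _ ('C(j, i)%:R * ((p i)%:~R + 1))); first by rewrite ler_wpM2l// ltW.
  by rewrite mulrDr lerD2l mulr1 ler_nat leq_pmull// expn_gt0.
apply/andP; split; first by apply: ler_sum => i _; case/andP: (h i).
apply: (@le_lt_trans _ _
  (\sum_(i < d.+1) (p i *+ 'C(j, i))%:~R + (extrap_lip_const k d)%:R)); last first.
  by rewrite ltrDl.
apply: (@le_trans _ _ (\sum_(i < d.+1) ((p i *+ 'C(j, i))%:~R + ((2 ^ i * 'C(j, i))%N%:R : R)))).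
  by apply: ler_sum => i _; case/andP: (h i).
rewrite big_split /= lerD2l -natr_sum ler_nat /extrap_lip_const (bigD1 (Ordinal jk))//=.
exact: leq_addr.
Qed.

End volume.

Section volume_bounds.
Variables (R : realType) (k d : nat).
Hypothesis dk : (d < k)%N.
Local Notation T := (measurableTypeR R).
Local Notation C := (@Ckd R k d).

Let zseq m (u : {ffun 'I_d.+1 -> 'I_m}) (i : nat) : int := (u (inord i))%:Z.

Let corner (c : nat) m (u : {ffun 'I_d.+1 -> 'I_m}) (i : nat) : int :=
  iter i (@diff _) (fun j => zseq u j - c%:Z) 0%N.

Let newton_sum_corner c m (u : {ffun 'I_d.+1 -> 'I_m}) j :
  newton_sum d.+1 (corner c u) j = extrap d (zseq u) j - c%:Z.
Proof. by rewrite -(@extrap_shift d (zseq u) (- c%:Z)). Qed.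

Let sum_const_set (I : finType) (S : {set I}) (x : R) :
  (\sum_(u \in [set` enum S]) x%:E)%E = (#|S|%:R * x)%:E.
Proof.
by rewrite -fsbig_seq ?enum_uniq// sumEFin big_enum sumr_const mulr_natl.
Qed.

(** The cubes with corners in the lattice set are disjoint, and lie in the
    polytope once the scale exceeds m by the rounding error. *)
Lemma card_lattice_le_volume (m c : nat) : (extrap_lip_const k d < c)%N ->
  ((#|lattice_set k d m|%:R / (m + c)%:R ^+ d.+1)%:E <=
    lebesgue_tuple (C : set (d.+1.-tuple T)))%E.
Proof.
move=> lc; have [mu <- muE] := lebesgue_tuple_spec R d.+1.
have L0 : 0 < (m + c)%:R :> R by rewrite ltr0n addn_gt0 (leq_ltn_trans _ lc) ?orbT.
set L := (m + c)%:R in L0 *.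
pose Q (u : {ffun 'I_d.+1 -> 'I_m}) : set (d.+1.-tuple T) := cube L (fun i => corner 0 u i).
have <- : mu (\bigcup_(u in [set` enum (lattice_set k d m)]) Q u) =
    (#|lattice_set k d m|%:R / L ^+ d.+1)%:E.
  rewrite measure_fin_bigcup.
  - rewrite -sum_const_set; apply: eq_fsbigr => u _.
    exact: lebesgue_cube.
  - exact: finite_seq.
  - move=> u v _ _ [y [/mem_set/(in_cube _ _ L0) yu /mem_set/(in_cube _ _ L0) yv]].
    apply/ffunP => i; apply/val_inj => /=; apply/eqP; rewrite -eqz_nat; apply/eqP.
    have e (w : {ffun 'I_d.+1 -> 'I_m}) : (w i)%:Z = newton_sum d.+1 (corner 0 w) i.
      rewrite newton_sum_corner subr0 extrap_id; last by rewrite -ltnS.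
      by rewrite /zseq inord_val.
    by rewrite !e; apply: eq_bigr => l _; rewrite yu yv.
  - by move=> u _; exact: measurable_cube.
apply: le_measure; rewrite ?inE.
- by apply: fin_bigcup_measurable => [|u _]; [exact: finite_seq|exact: measurable_cube].
- exact: measurable_Ckd.
move=> y [u]; rewrite /= mem_enum inE => /forallP uS /mem_set/(in_cube _ _ L0) yu.
rewrite (CkdE R dk) => j jk.
have := newton_sum_floor (p := corner 0 u) jk yu; rewrite newton_sum_corner subr0.
have := uS (Ordinal jk); rewrite /= -/(zseq u); set e := extrap d _ j.
move=> /andP[e0 em] /andP[h1 h2].
have e0' : 0 <= e%:~R :> R by rewrite ler0z.
have em' : e%:~R + 1 <= m%:R :> R by rewrite pmulrn -intrD1 ler_int lezD1.
have lc' : (extrap_lip_const k d)%:R + 1 <= c%:R :> R by rewrite natr1 ler_nat.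
apply/andP; split.
  by rewrite -(pmulr_rge0 _ L0); apply: le_trans h1.
by rewrite -(ltr_pM2l L0) mulr1; apply: (lt_le_trans h2); rewrite /L natrD; lra.
Qed.

(** The cubes that meet the polytope have their corners in a lattice set,
    after a translation by the constant sequence c that makes the rounded
    values nonnegative. *)
Lemma volume_le_card_lattice (m c : nat) : (0 < m)%N -> (extrap_lip_const k d < c)%N ->
  (lebesgue_tuple (C : set (d.+1.-tuple T)) <=
    (#|lattice_set k d (m + c)|%:R / m%:R ^+ d.+1)%:E)%E.
Proof.
case: m => // m _ lc; have [mu <- muE] := lebesgue_tuple_spec R d.+1.
have L0 : 0 < m.+1%:R :> R by rewrite ltr0n.
pose Q (u : {ffun 'I_d.+1 -> 'I_(m.+1 + c)}) : set (d.+1.-tuple T) :=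
  cube m.+1%:R (fun i => corner c u i).
have <- : (\sum_(u \in [set` enum (lattice_set k d (m.+1 + c))]) mu (Q u) =
    (#|lattice_set k d (m.+1 + c)|%:R / m.+1%:R ^+ d.+1)%:E)%E.
  by rewrite -sum_const_set; apply: eq_fsbigr => u _; exact: lebesgue_cube.
apply: content_sub_fsum.
- exact: finite_seq.
- by move=> u _; exact: measurable_cube.
- exact: measurable_Ckd.
move=> y; rewrite (CkdE R dk) => Cy.
pose p (i : nat) : int := Num.floor (m.+1%:R * tnth y (inord i)).
have pE (i : 'I_d.+1) : p i = Num.floor (m.+1%:R * tnth y i) by rewrite /p inord_val.
have pb j : (j < k)%N -> 0 <= newton_sum d.+1 p j + c%:Z < (m.+1 + c)%N%:Z.
  move=> jk; have /andP[h1 h2] := newton_sum_floor jk pE.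
  have /andP[] := Cy j jk; set S := \sum_(i < d.+1) _ in h1 h2 *.
  rewrite -(pmulr_rge0 _ L0) -(ltr_pM2l L0) mulr1 => S0 S1.
  have lc' : (extrap_lip_const k d)%:R + 1 <= c%:R :> R by rewrite natr1 ler_nat.
  rewrite -(ler_int R) -(ltr_int R) PoszD !rmorphD /= -!pmulrn.
  by apply/andP; split; lra.
have pb' i : (i <= d)%N -> 0 <= newton_sum d.+1 p i + c%:Z < (m.+1 + c)%N%:Z.
  by move=> id; apply: pb; exact: leq_ltn_trans dk.
pose u : {ffun 'I_d.+1 -> 'I_(m.+1 + c)} :=
  [ffun i : 'I_d.+1 => inord (absz (newton_sum d.+1 p i + c%:Z)) : 'I_(m + c).+1].
have uE (i : 'I_d.+1) : (u i)%:Z = newton_sum d.+1 p i + c%:Z.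
  have := pb' i (ltn_ord i); rewrite ffunE; move: (newton_sum _ _ _ + _) => e ei.
  have h : (absz e < (m + c).+1)%N by lia.
  by rewrite (inordK h) gez0_abs//; lia.
exists u.
  rewrite /= mem_enum inE; apply/forallP => j.
  have -> : extrap d (fun i => (u (inord i))%:Z) j = newton_sum d.+1 p j + c%:Z.
    rewrite -extrap_newton_sum -extrap_shift; apply: extrap_ext => i id.
    by rewrite uE inordK.
  exact: pb.
apply/set_mem/(in_cube _ _ L0) => i; rewrite -pE /corner.
rewrite (@iter_diff_ext _ _ _ (newton_sum d.+1 p)) ?iter_diff_newton_sum0// => l li.
by rewrite /zseq uE inordK ?addrK// add0n ltnS (leq_trans li)// -ltnS.
Qed.

Theorem volume_lattice : exists V : R,
  [/\ lebesgue_tuple (C : set (d.+1.-tuple T)) = V%:E,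
      forall m, #|lattice_set k d m|%:R <= V * (m + (extrap_lip_const k d).+1)%:R ^+ d.+1 &
      forall m, V * m%:R ^+ d.+1 <= #|lattice_set k d (m + (extrap_lip_const k d).+1)|%:R].
Proof.
have le1 m := card_lattice_le_volume m (ltnSn (extrap_lip_const k d)).
have le2 m m0 := @volume_le_card_lattice m _ m0 (ltnSn (extrap_lip_const k d)).
have fin : lebesgue_tuple (C : set (d.+1.-tuple T)) \is a fin_num.
  rewrite fin_real// (lt_le_trans (ltNyr _) (le1 0%N)).
  exact: (le_lt_trans (le2 1%N isT) (ltry _)).
exists (fine (lebesgue_tuple (C : set (d.+1.-tuple T)))); split.
- by rewrite fineK.
- move=> m; have := le1 m; rewrite -(fineK fin) lee_fin ler_pdivrMr// exprn_gt0// ltr0n addnS.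
- move=> [|m]; first by rewrite expr0n mulr0.
  have := le2 m.+1 isT; rewrite -(fineK fin) lee_fin ler_pdivlMr// exprn_gt0.
Qed.

End volume_bounds.

(** * A lower bound for the volume *)

Section partial_sums.
Variable R : realType.
Local Notation T := (measurableTypeR R).

(** A parallelepiped: in the coordinates given by the partial sums it is a
    unit cube. The starting value v is what makes its sections of the same
    form. *)
Definition psum_set n (v : R) (b : nat -> R) : set (n.-tuple T) :=
  [set y | forall i : 'I_n, 0 <= v + \sum_(l < n | (l <= i)%N) b l * tnth y l < 1].

Arguments psum_set : clear implicits.

Lemma measurable_psum_set n v b : measurable (psum_set n v b).
Proof.
have -> : psum_set n v b = \bigcap_(i in [set: 'I_n]) [set y : n.-tuple T |
    0 <= v + \sum_(l < n) (if (l <= i)%N then b l else 0) * tnth y l < 1].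
  have e (y : n.-tuple R) i : \sum_(l < n | (l <= i)%N) b l * tnth y l =
      \sum_(l < n) (if (l <= i)%N then b l else 0) * tnth y l.
    by rewrite big_mkcond; apply: eq_bigr => l _; case: ifP => // _; rewrite mul0r.
  by apply/seteqP; split => y h i; have := h i; rewrite /mkset e//; apply.
apply: fin_bigcap_measurable; first exact: finite_finset.
by move=> i _; exact: measurable_slab.
Qed.

Lemma xsection_psum_set n v b (x : R) :
  xsection (@tcons T n @^-1` psum_set n.+1 v b) x =
  if 0 <= v + b 0%N * x < 1 then psum_set n (v + b 0%N * x) (fun l => b l.+1) else set0.
Proof.
have e0 (t : n.-tuple T) :
    \sum_(l < n.+1 | (l <= @ord0 n)%N) b l * tnth (tcons (x, t)) l = b 0%N * x.
  rewrite big_mkcond big_ord_recl /= tnth0 big1 ?addr0//.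
have eS (t : n.-tuple T) (i : 'I_n) :
    \sum_(l < n.+1 | (l <= lift ord0 i)%N) b l * tnth (tcons (x, t)) l =
    b 0%N * x + \sum_(l < n | (l <= i)%N) b l.+1 * tnth t l.
  rewrite big_mkcond big_ord_recl /= tnth0; congr (_ + _).
  rewrite [RHS]big_mkcond; apply: eq_bigr => l _.
  by rewrite /tcons tnthS.
apply/seteqP; split => t; rewrite /xsection /= inE.
  move=> h; have := h ord0; rewrite e0 => ->.
  by move=> i; have := h (lift ord0 i); rewrite eS addrA.
case: ifP => // h0 h i.
by case: (unliftP ord0 i) => [j|] ->; rewrite ?e0// eS addrA; exact: h.
Qed.

(** Fubini's theorem: fixing the first coordinate x in an interval of length 1
    / b 0 leaves a set of the same form, with v replaced by v + b 0 * x, and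
    its volume does not depend on v. *)
Lemma lebesgue_psum_set n v b : (forall l, (l < n)%N -> 0 < b l) ->
  lebesgue_tuple (psum_set n v b) = (\prod_(l < n) (b l)^-1)%:E.
Proof.
elim: n v b => [|n ih] v b b0.
  rewrite big_ord0 /= /dirac indicE mem_set// => -[] //.
rewrite big_ord_recl /= /pushforward /product_measure1.
have b00 : 0 < b 0%N by exact: b0.
set c := \prod_(l < n) _.
pose D : set T := `[- v / b 0%N, (1 - v) / b 0%N[%classic.
rewrite (_ : (fun x => _) = (cst c%:E) \_ D).
  rewrite -integral_mkcond integral_cst//; last exact: measurable_itv.
  have mD : lebesgue_measure D = ((b 0%N)^-1)%:E.
    rewrite lebesgue_measure_itv /= lte_fin ltr_pM2r ?invr_gt0// ltrBrDl subrr ltr01.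
    by rewrite -EFinB -mulrBl opprK subrK mul1r.
  by rewrite -[X in (_ * X)%E]/(lebesgue_measure D) mD -EFinM mulrC.
apply/funext => x; rewrite /= xsection_psum_set patchE.
have -> : (x \in D) = (0 <= v + b 0%N * x < 1).
  rewrite mem_setE in_itv /= ler_pdivrMr// ltr_pdivlMr// ltrBrDl [x * _]mulrC.
  by rewrite -subr_ge0 opprK addrC.
case: ifP => _; last by have [mu <- _] := lebesgue_tuple_spec R n; rewrite measure0.
by rewrite ih// => l ln; exact: b0.
Qed.

(** Summation by parts writes the sum as a combination of the partial sums of
    u with the nonnegative weights t i - t i.+1 and t d, whose total is t 0.
    The induction subtracts the last weight from all the others. *)
Lemma abel_bounds d (t u : nat -> R) :
  (forall i, (i <= d)%N -> 0 <= t i) ->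
  (forall i j, (i <= j)%N -> (j <= d)%N -> t j <= t i) ->
  (forall i, (i <= d)%N -> 0 <= \sum_(l < i.+1) u l < 1) ->
  0 <= \sum_(i < d.+1) t i * u i <= t 0%N /\
  (0 < t 0%N -> \sum_(i < d.+1) t i * u i < t 0%N).
Proof.
elim: d t => [|d ih] t t0 tS hu.
  have := hu 0%N (leqnn _); have := t0 0%N (leqnn _); rewrite !big_ord1 => t00 /andP[u0 u1].
  split; first by rewrite mulr_ge0//= ler_piMr// ltW.
  by move=> tp; rewrite gtr_pMr.
have [] := ih (fun l => t l - t d.+1).
- by move=> i id; rewrite subr_ge0 tS// ltnW.
- by move=> i j ij jd; rewrite lerD2r tS// leqW.
- by move=> i id; rewrite hu// leqW.
have -> : \sum_(i < d.+2) t i * u i =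
    \sum_(i < d.+1) (t i - t d.+1) * u i + t d.+1 * \sum_(l < d.+2) u l.
  rewrite big_ord_recr [X in _ = _ + _ * X]big_ord_recr /= mulrDr addrA.
  rewrite mulr_sumr -big_split /=; congr (_ + _).
  by apply: eq_bigr => i _; rewrite -mulrDl subrK.
have := hu d.+1 (leqnn _); have := t0 d.+1 (leqnn _); have := t0 0%N (leq0n _).
move: (\sum_(i < d.+1) _) (\sum_(l < d.+2) _) => P S t00 td0 /andP[S0 S1] /andP[P0 P1] P2.
have h1 : 0 <= t d.+1 * S by rewrite mulr_ge0.
have h2 : t d.+1 * S <= t d.+1 by rewrite ler_piMr// ltW.
split; first by apply/andP; split; lra.
move=> tp; move: td0; rewrite le_eqVlt => /predU1P[td|td].
  by have := P2; rewrite -td mul0r subr0 addr0; exact.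
have : t d.+1 * S < t d.+1 by rewrite gtr_pMr.
by move: P1; lra.
Qed.

(** The ratios of 'C(j, i) to 'C(k - 1, i) start at 1 and decrease with i when
    j <= k - 1, so every form that defines the polytope is a convex
    combination of the partial sums. *)
Lemma psum_set_sub_Ckd (k d : nat) : (d + 2 <= k)%N ->
  psum_set d.+1 0 (fun i => 'C(k - 1, i)%:R) `<=` (@Ckd R k d : set (d.+1.-tuple T)).
Proof.
move=> dk y yA; rewrite CkdE; last by lia.
move=> j jk.
have binp i : (i <= d)%N -> 0 < 'C(k - 1, i)%:R :> R by move=> id; rewrite ltr0n bin_gt0; lia.
pose t i : R := 'C(j, i)%:R / 'C(k - 1, i)%:R.
have tS i : (i < d)%N -> t i.+1 <= t i.
  move=> id; rewrite /t ler_pdivrMr ?binp// mulrAC ler_pdivlMr ?binp 1?ltnW//.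
  rewrite -!natrM ler_nat -(@leq_pmul2l i.+1)//.
  rewrite mulnA mul_bin_left mulnCA mul_bin_left (mulnC (j - i)%N) -mulnA.
  by rewrite leq_mul2l leq_mul2r; apply/orP; right; apply/orP; right; lia.
have tm i e : (i <= e)%N -> (e <= d)%N -> t e <= t i.
  elim: e => [|e ih]; first by rewrite leqn0 => /eqP ->.
  rewrite leq_eqVlt => /predU1P[->//|ie] ed.
  by apply: le_trans (tS _ ed) (ih _ _) => //; exact: ltnW.
pose u i : R := 'C(k - 1, i)%:R * tnth y (inord i).
have -> : \sum_(i < d.+1) 'C(j, i)%:R * tnth y i = \sum_(i < d.+1) t i * u i.
  apply: eq_bigr => i _; rewrite /t /u inord_val mulrA divfK//.
  by rewrite gt_eqF// binp// -ltnS.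
have [] := @abel_bounds d t u _ tm _.
- by move=> i _; rewrite divr_ge0.
- move=> i id; have := yA (inord i); rewrite add0r inordK//.
  rewrite (big_ord_widen _ u (id : (i.+1 <= d.+1)%N)).
  by rewrite (eq_bigr (fun l : 'I_d.+1 => u l))// => l _; rewrite /u inord_val.
rewrite /t !bin0 divr1 => /andP[h1 _] h2.
by rewrite h1 h2.
Qed.

Theorem volume_ge (k d : nat) : (d + 2 <= k)%N ->
  (((\prod_(1 <= i < d.+1) 'C((k - 1)%N, i)%:R)^-1)%:E
        <= lebesgue_tuple (@Ckd R k d))%E.
Proof.
move=> dk.
rewrite big_add1 succnK big_mkord.
apply: (@le_trans _ _ (lebesgue_tuple (psum_set d.+1 0 (fun i => 'C(k - 1, i)%:R : R)))).
  rewrite lebesgue_psum_set => [|l ld]; last by rewrite ltr0n bin_gt0; lia.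
  by rewrite lee_fin big_ord_recl bin0 invr1 mul1r prodfV.
have [mu <- _] := lebesgue_tuple_spec R d.+1.
have mA := @measurable_psum_set d.+1 0 (fun i => 'C(k - 1, i)%:R).
have dk' : (d < k)%N by lia.
have mC := @measurable_Ckd R _ _ dk'.
exact: (le_measure mu (mem_set mA) (mem_set mC) (psum_set_sub_Ckd dk)).
Qed.

End partial_sums.

(** * Mean values of iterated differences *)

Section rays.
Variable R : realType.
Implicit Types (F G : R -> R) (P : R -> Prop).

Lemma nearyP P : (\forall x \near +oo, P x) <-> exists M, forall x, M < x -> P x.
Proof.
by split => [[M [_ h]]|[M h]]; exists M => //; split; [exact: num_real|].
Qed.

Lemma is_derive_translate F (h x l : R) :
  is_derive (x + h) 1 F l -> is_derive x 1 (fun y => F (y + h)) l.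
Proof.
move=> Fl; have := @is_derive1_comp _ F (shift h) x _ _ Fl (is_derive_shift x 1 h).
by rewrite mulr1.
Qed.

Lemma derive_ray_continuous F G (M a b : R) : (forall x : R, M < x -> is_derive x 1 F (G x)) ->
  M < a -> {within `[a, b], continuous F}.
Proof.
move=> FG Ma; apply: derivable_within_continuous => x.
rewrite in_itv /= => /andP[ax _].
by have [] := FG x (lt_le_trans Ma ax).
Qed.

Lemma mvt_ray F G (M : R) : (forall x : R, M < x -> is_derive x 1 F (G x)) ->
  forall a b, M < a -> a <= b -> exists2 c, a <= c <= b & F b - F a = G c * (b - a).
Proof.
move=> FG a b Ma ab.
have [x|c cab ->] := @MVT_segment _ F G a b ab _ (derive_ray_continuous FG Ma).
  by rewrite in_itv /= => /andP[ax _]; apply: FG; exact: lt_trans ax.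
by exists c => //; move: cab; rewrite in_itv.
Qed.

Fixpoint iterated_diff (hs : seq R) F : R -> R :=
  if hs is h :: hs' then fun x => iterated_diff hs' F (x + h) - iterated_diff hs' F x else F.

Lemma is_derive_iterated_diff hs F G (M : R) : all (fun h => 0 <= h) hs ->
  (forall x, M < x -> is_derive x 1 F (G x)) ->
  forall x, M < x -> is_derive x 1 (iterated_diff hs F) (iterated_diff hs G x).
Proof.
elim: hs => [|h hs ih] //= /andP[h0 hs0] FG x Mx.
have := ih hs0 FG x Mx; have := ih hs0 FG (x + h) (lt_le_trans Mx _).
rewrite lerDl => /(_ h0) /is_derive_translate d1 d2.
exact: is_deriveB.
Qed.

(** Differences commute with derivatives, so the mean value theorem may be
    applied once for each step. *)
Lemma mvt_iterated_diff hs (F : nat -> R -> R) (M : R) : all (fun h => 0 <= h) hs ->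
  (forall i x, (i < size hs)%N -> M < x -> is_derive x 1 (F i) (F i.+1 x)) ->
  forall x, M < x -> exists2 c, x <= c <= x + \sum_(h <- hs) h &
    iterated_diff hs (F 0%N) x = (\prod_(h <- hs) h) * F (size hs) c.
Proof.
elim: hs F => [|h hs ih] F /=.
  by move=> _ _ x _; exists x; rewrite ?big_nil ?mul1r// addr0 lexx.
move=> /andP[h0 hs0] dF x Mx.
have dD := is_derive_iterated_diff hs0 (dF 0%N ^~ isT).
have xh : x <= x + h by rewrite lerDl.
have [c /andP[xc ch] ->] := mvt_ray dD Mx xh.
have [] := ih (fun i => F i.+1) hs0 _ c (lt_le_trans Mx xc).
  by move=> i y ih' My; exact: dF.
move=> e /andP[ce ec] ->; exists e.
  by rewrite (le_trans xc ce)/= big_cons addrA (le_trans ec)// lerD2r.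
by rewrite big_cons; ring.
Qed.

End rays.

(** * Growth of primitives *)

Section growth.
Variable R : realType.
Implicit Types (F G u v : R -> R).

Lemma expR1_ge1 : 1 <= expR 1 :> R.
Proof. by rewrite ltW// expR_gt1. Qed.

Lemma lnX_ge1 (j : nat) (x : R) : expR 1 <= x -> 1 <= x ^+ j * ln x.
Proof.
move=> ex; have x1 : 1 <= x by apply: le_trans ex; exact: expR1_ge1.
rewrite mulr_ege1 ?exprn_ege1//.
by rewrite -[leLHS]expRK ler_ln// posrE ?expR_gt0// (lt_le_trans ltr01).
Qed.

(** The mean value theorem on [a, x]: the bound for the derivative increases
    with x. *)
Lemma integrate_ln_bound F G (C : R) j :
  (\forall x \near +oo, is_derive (x : R) 1 F (G x)) ->
  (\forall x \near +oo, G x <= C * (x ^+ j * ln x)) ->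
  exists2 C', 0 <= C' & \forall x \near +oo, F x <= C' * (x ^+ j.+1 * ln x).
Proof.
move=> /nearyP[M1 h1] /nearyP[M2 h2].
pose M := Num.max (Num.max M1 M2) (expR 1).
have M0 : expR 1 <= M by rewrite le_max lexx orbT.
have M01 : M1 <= M by rewrite !le_max lexx.
have M02 : M2 <= M by rewrite !le_max lexx orbT.
pose a := M + 1; have Ma : M < a by rewrite ltrDl.
exists (`|F a| + `|C|); first by rewrite addr_ge0.
apply/nearyP; exists a => x ax.
have [c /andP[ac cx]] := mvt_ray h1 (le_lt_trans M01 Ma) (ltW ax).
have c_gt : M < c by exact: lt_le_trans ac.
have c0 : 0 < c by apply: lt_trans c_gt; apply: lt_le_trans M0; exact: expR_gt0.
have ec : expR 1 <= c by exact: le_trans M0 (ltW c_gt).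
have x0 : 0 < x by exact: lt_le_trans cx.
have a0 : 0 < a by apply: lt_trans Ma; apply: lt_le_trans M0; exact: expR_gt0.
have := h2 c (le_lt_trans M02 c_gt) => Gc Fe.
have lc : 0 <= c ^+ j * ln c by apply: le_trans (lnX_ge1 j ec).
have lx : c ^+ j * ln c <= x ^+ j * ln x.
  apply: ler_pM => //; first by rewrite exprn_ge0// ltW.
  - by apply: ln_ge0; apply: le_trans ec; exact: expR1_ge1.
  - by rewrite lerXn2r ?nnegrE ?(ltW c0) ?(ltW x0).
  - by rewrite ler_ln.
have l1 : 1 <= x ^+ j.+1 * ln x by apply: lnX_ge1; exact: le_trans cx.
have h3 : G c <= `|C| * (x ^+ j * ln x).
  apply: le_trans Gc _; apply: (@le_trans _ _ (`|C| * (c ^+ j * ln c))).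
    by rewrite ler_wpM2r// ler_norm.
  by rewrite ler_wpM2l.
have h4 : G c * (x - a) <= `|C| * (x ^+ j.+1 * ln x).
  have -> : `|C| * (x ^+ j.+1 * ln x) = `|C| * (x ^+ j * ln x) * x by rewrite exprS; ring.
  apply: (@le_trans _ _ (`|C| * (x ^+ j * ln x) * (x - a))).
    by rewrite ler_wpM2r// subr_ge0 ltW.
  rewrite ler_wpM2l ?gerBl ?(ltW a0)//.
  by apply: mulr_ge0 => //; exact: le_trans lx.
have h5 : F a <= `|F a| * (x ^+ j.+1 * ln x).
  by apply: le_trans (ler_norm _) _; rewrite ler_peMr.
by rewrite mulrDl; lra.
Qed.

(** The mean value theorem on [x / 2, x], where the derivative is at least c
    (x / 2)^j. *)
Lemma integrate_power_bound F G (c : R) j : 0 < c ->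
  (\forall x \near +oo, is_derive (x : R) 1 F (G x)) ->
  (\forall x \near +oo, c * x ^+ j <= G x) ->
  exists2 c', 0 < c' & \forall x \near +oo, c' * x ^+ j.+1 <= F x.
Proof.
move=> c0 /nearyP[M1 h1] /nearyP[M2 h2].
pose M := Num.max (Num.max M1 M2) 1.
have M0 : 1 <= M by rewrite le_max lexx orbT.
have M01 : M1 <= M by rewrite !le_max lexx.
have M02 : M2 <= M by rewrite !le_max lexx orbT.
pose a := M + 1; have Ma : M < a by rewrite ltrDl.
pose e : R := 2 ^- j.+1.
have e0 : 0 < e by rewrite invr_gt0 exprn_gt0.
exists (c * e / 2); first by rewrite !divr_gt0// mulr_gt0.
pose K := `|F a| * 2 / (c * e).
apply/nearyP; exists (Num.max (2 * a) K) => x; rewrite gt_max => /andP[ax Kx].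
have x2 : a <= x / 2 by rewrite ler_pdivlMr// mulrC ltW.
have x0 : 0 < x / 2 by apply: lt_le_trans x2; lra.
have xx : x / 2 <= x by lra.
have [c1 /andP[ac1 c1x] Fe1] := mvt_ray h1 (le_lt_trans M01 Ma) x2.
have [c2 /andP[xc2 c2x] Fe2] := mvt_ray h1 (le_lt_trans M01 (lt_le_trans Ma x2)) xx.
have g1 : 0 <= G c1.
  apply: le_trans (h2 c1 _); last exact: le_lt_trans M02 (lt_le_trans Ma ac1).
  by rewrite mulr_ge0 ?ltW// exprn_gt0//; lra.
have g2 : c * (x / 2) ^+ j <= G c2.
  apply: le_trans (h2 c2 _); last first.
    by apply: le_lt_trans M02 (lt_le_trans Ma _); exact: le_trans xc2.
  have c20 : 0 < c2 by exact: lt_le_trans xc2.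
  by rewrite ler_pM2l// lerXn2r ?nnegrE ?(ltW x0) ?(ltW c20).
have F1 : 0 <= F (x / 2) - F a by rewrite Fe1 mulr_ge0// subr_ge0.
have F2 : c * (x / 2) ^+ j.+1 <= F x - F (x / 2).
  have -> : c * (x / 2) ^+ j.+1 = c * (x / 2) ^+ j * (x / 2) by rewrite exprSr; ring.
  by rewrite Fe2 (_ : x - x / 2 = x / 2) ?ler_pM2r//; lra.
have xE : (x / 2) ^+ j.+1 = x ^+ j.+1 * e by rewrite exprMn exprVn.
have xp : x <= x ^+ j.+1 by rewrite ler_eXnr//; lra.
have Kp : `|F a| * 2 <= c * e * x ^+ j.+1.
  have := le_trans (ltW Kx) xp; rewrite /K ler_pdivrMr ?mulr_gt0// => h.
  by rewrite (mulrC (c * e)).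
have := ler_norm (- F a); rewrite normrN.
move: F1 F2; rewrite xE; move: Kp; set X := x ^+ j.+1.
have -> : c * e / 2 * X = c * e * X / 2 by ring.
have -> : c * (X * e) = c * e * X by ring.
move: (c * e * X) => Y; lra.
Qed.

(** Comparison with the primitive c ln; the factor x^0 makes this the first
    step of a repeated use of the bound for x^j ln x. *)
Lemma integrate_inv_bound F u (c : R) :
  (\forall x \near +oo, is_derive (x : R) 1 F (u x)) ->
  (\forall x \near +oo, u x <= c / x) ->
  exists2 C, 0 <= C & \forall x \near +oo, F x <= C * (x ^+ 0 * ln x).
Proof.
move=> /nearyP[M1 h1] /nearyP[M2 h2].
pose M := Num.max (Num.max M1 M2) (expR 1).
have M0 : expR 1 <= M by rewrite le_max lexx orbT.
have M01 : M1 <= M by rewrite !le_max lexx.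
have M02 : M2 <= M by rewrite !le_max lexx orbT.
have e0 : 0 < expR 1 :> R := expR_gt0 1.
pose a := M + 1; have Ma : M < a by rewrite ltrDl.
pose D x := F x - c * ln x.
have dD x : M < x -> is_derive x 1 D (u x - c * x^-1).
  move=> Mx; have x0 : 0 < x by apply: lt_trans Mx; exact: lt_le_trans M0.
  apply: is_deriveB; first by apply: h1; exact: le_lt_trans Mx.
  exact: (@is_deriveZ _ _ _ _ c _ _ _ (is_derive1_ln x0)).
exists (`|D a| + `|c|); first by rewrite addr_ge0.
apply/nearyP; exists a => x ax.
have [y /andP[ay yx] De] := mvt_ray dD Ma (ltW ax).
have : u y <= c / y by apply: h2; apply: le_lt_trans M02 _; exact: lt_le_trans ay.
rewrite -subr_le0 => uy.
have : D x - D a <= 0 by rewrite De mulr_le0_ge0// subr_ge0 ltW.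
have l1 := @lnX_ge1 0 x (le_trans M0 (ltW (lt_trans Ma ax))).
have h3 : `|D a| <= `|D a| * (x ^+ 0 * ln x) by rewrite ler_peMr.
have h4 : c * (x ^+ 0 * ln x) <= `|c| * (x ^+ 0 * ln x).
  by rewrite ler_wpM2r ?ler_norm// (le_trans ler01).
have Dx : D x = F x - c * ln x by [].
have := ler_norm (D a); rewrite mulrDl Dx; move: h3 h4; rewrite expr0 mul1r; lra.
Qed.

End growth.

(** * Derivatives in a Hardy field *)

Section hardy.
Variables (R : realType) (H : set (R -> R)).
Hypothesis HH : hardy_field H.
Implicit Types (h : R -> R).

(** An element of the field that is not eventually 0 has an inverse, so it
    eventually has no zero; being eventually differentiable, it has a constant
    sign by the intermediate value theorem. *)
Lemma hardy_sign h : H h ->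
  (\forall x \near +oo, 0 < h x) \/ (\forall x \near +oo, h x <= 0).
Proof.
move=> Hh; have [h0|h0] := pselect (\forall x \near +oo, h x = 0).
  by right; apply: filterS h0 => x ->.
have [g _ /nearyP[M1 hg]] := hardy_inv HH Hh h0.
have /nearyP[M2 dh] := hardy_derivable HH Hh.
pose M := Num.max M1 M2.
have M01 : M1 <= M by rewrite le_max lexx.
have M02 : M2 <= M by rewrite le_max lexx orbT.
have hn0 x : M < x -> h x <> 0.
  move=> Mx hx0; have := hg x (le_lt_trans M01 Mx).
  by rewrite hx0 mul0r => /eqP; rewrite eq_sym oner_eq0.
have nosign a b : M < a -> a <= b -> Num.min (h a) (h b) <= 0 <= Num.max (h a) (h b) -> False.
  move=> Ma ab hab; have cont : {within `[a, b], continuous h}.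
    apply: derivable_within_continuous => x; rewrite in_itv /= => /andP[ax _].
    by apply: dh; exact: le_lt_trans M02 (lt_le_trans Ma ax).
  have [c cab hc] := IVT ab cont hab; case: (hn0 c _ hc).
  by move: cab; rewrite in_itv /= => /andP[ac _]; exact: lt_le_trans ac.
have [[a Ma ha]|no] := pselect (exists2 a, M < a & 0 < h a).
  left; apply/nearyP; exists M => x Mx; rewrite ltNge; apply/negP => hx.
  have [ax|/ltW xa] := leP a x.
    by apply: (nosign a x Ma ax); rewrite ge_min le_max hx (ltW ha) orbT.
  by apply: (nosign x a Mx xa); rewrite ge_min le_max hx (ltW ha) orbT.
right; apply/nearyP; exists M => x Mx; rewrite leNgt; apply/negP => hx.
by apply: no; exists x.
Qed.

Lemma hardy_zero : H (fun=> 0).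
Proof.
have := hardy_sub HH (hardy_one HH) (hardy_one HH).
by congr H; apply/funext => x; rewrite subrr.
Qed.

Lemma hardy_nat n : H (fun=> n%:R).
Proof.
elim: n => [|n ih]; first exact: hardy_zero.
have := hardy_sub HH ih (hardy_sub HH hardy_zero (hardy_one HH)).
by congr H; apply/funext => x; rewrite sub0r opprK natr1.
Qed.

Lemma hardy_inv_nat n : H (fun=> n.+1%:R^-1).
Proof.
have n0 : n.+1%:R != 0 :> R by rewrite pnatr_eq0.
have [|g Hg g1] := hardy_inv HH (hardy_nat n.+1).
  by move=> /nearyP[M /(_ (M + 1))]; rewrite ltrDl ltr01 => /(_ isT)/eqP; exact/negP.
apply: (hardy_germ HH Hg); apply: filterS g1 => x gx.
by apply: (mulfI n0); rewrite gx divff.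
Qed.

Lemma hardy_derive1n h i : H h -> H (derive1n i h).
Proof. by move=> Hh; elim: i => [//|i ih]; rewrite derive1nS; exact: hardy_derive. Qed.

Lemma hardy_is_derive h : H h -> \forall x \near +oo, is_derive (x : R) 1 h (derive1 h x).
Proof.
move=> /(hardy_derivable HH); apply: filterS => x dh.
by rewrite derive1E; exact: derivableP.
Qed.

Section growth.
Variables (f : R -> R) (d : nat).
Hypotheses (Hf : H f) (d_gt0 : (0 < d)%N).
Hypothesis f_lower : asymp_lt (fun x : R => x ^+ d * ln x) f.
Hypothesis f_upper : asymp_lt f (fun x : R => x ^+ d.+1).

Let F i := derive1n i f.

Let HF i : H (F i). Proof. exact: hardy_derive1n. Qed.

Let dF i : \forall x \near +oo, is_derive (x : R) 1 (F i) (F i.+1 x).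
Proof. by rewrite /F derive1nS; exact: (hardy_is_derive (HF i)). Qed.

Lemma not_le_xln (C : R) : ~ (\forall x \near +oo, f x <= C * (x ^+ d * ln x)).
Proof.
move=> hC; move/cvgryPgt : f_lower => /(_ C) hl.
have [M hM] := (nearyP _).1 (filterI hC hl).
pose x := Num.max (M + 1) (expR 1).
have [] := hM x; first by rewrite lt_max ltrDl ltr01.
have l0 : 0 < x ^+ d * ln x by apply: (lt_le_trans ltr01 (lnX_ge1 d _)); rewrite le_max lexx orbT.
by rewrite ltr_pdivlMr// => h1 /(le_lt_trans h1); rewrite ltxx.
Qed.

Lemma not_ge_pow (c : R) : 0 < c -> ~ (\forall x \near +oo, c * x ^+ d.+1 <= f x).
Proof.
move=> c0 hc; move/cvgryPgt : f_upper => /(_ c^-1) hu.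
have [M hM] := (nearyP _).1 (filterI hc hu).
pose x := Num.max (M + 1) 1.
have x0 : 0 < x by rewrite lt_max ltr01 orbT.
have X0 : 0 < x ^+ d.+1 by rewrite exprn_gt0.
have [] := hM x; first by rewrite lt_max ltrDl ltr01.
move=> h1; have fx : 0 < f x by apply: lt_le_trans h1; rewrite mulr_gt0.
rewrite ltr_pdivlMr// => h2.
have : c^-1 * (c * x ^+ d.+1) <= c^-1 * f x by rewrite ler_pM2l ?invr_gt0.
by rewrite mulKf ?gt_eqF// => /le_lt_trans /(_ h2); rewrite ltxx.
Qed.

Lemma descend_ln (C : R) i : (i <= d)%N ->
  (\forall x \near +oo, F i x <= C * (x ^+ (d - i) * ln x)) -> False.
Proof.
elim: i C => [|i ih] C id hi; first by apply: (@not_le_xln C); rewrite subn0 in hi.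
have [C' _ hC'] := integrate_ln_bound (dF i) hi.
by apply: (ih C' (ltnW id)); rewrite subnS prednK ?subn_gt0// in hC'.
Qed.

Lemma descend_pow (c : R) i : 0 < c -> (i <= d.+1)%N ->
  (\forall x \near +oo, c * x ^+ (d.+1 - i) <= F i x) -> False.
Proof.
elim: i c => [|i ih] c c0 id hi; first by apply: (not_ge_pow c0); rewrite subn0 in hi.
have [c' c'0 hc'] := integrate_power_bound c0 (dF i) hi.
by apply: (ih c' c'0 (ltnW id)); rewrite subnS prednK ?subn_gt0// in hc'.
Qed.

(** Integrating d + 1 times would give f = O(x^d log x), against the lower
    growth condition. *)
Lemma top_derivative_not_le_inv (c : R) : ~ (\forall x \near +oo, F d.+1 x <= c / x).
Proof.
move=> h; have [C _ hC] := integrate_inv_bound (dF d) h.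
by apply: (@descend_ln C d (leqnn d)); rewrite subnn.
Qed.

Lemma top_derivative_gt0 : \forall x \near +oo, 0 < F d.+1 x.
Proof.
have [//|h] := hardy_sign (HF d.+1).
exfalso; apply: (@top_derivative_not_le_inv 0); apply: filterS h => x.
by rewrite mul0r.
Qed.

(** Comparison with the constant 1 / (n + 1) of the Hardy field: staying above
    it would make f at least a constant times x^(d + 1). *)
Lemma top_derivative_le_inv n : \forall x \near +oo, F d.+1 x <= n.+1%:R^-1.
Proof.
have [h|h] := hardy_sign (hardy_sub HH (HF d.+1) (hardy_inv_nat n)); last first.
  by apply: filterS h => x; rewrite subr_le0.
exfalso; apply: (@descend_pow n.+1%:R^-1 d.+1) => //.
by apply: filterS h => x; rewrite subnn expr0 mulr1 subr_gt0 => /ltW.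
Qed.

(** The next derivative has a constant sign, and a positive nondecreasing
    function does not tend to 0. *)
Lemma top_derivative_decreasing : \forall x \near +oo, F d.+2 x <= 0.
Proof.
have [/nearyP[M1 h1]|//] := hardy_sign (HF d.+2).
have /nearyP[M2 h2] := dF d.+1.
have /nearyP[M3 h3] := top_derivative_gt0.
exfalso; pose a := Num.max (Num.max M1 M2) M3 + 1.
have Ma : Num.max (Num.max M1 M2) M3 < a by rewrite ltrDl.
have [M1a M2a M3a] : [/\ M1 < a, M2 < a & M3 < a].
  by split; apply: le_lt_trans Ma; rewrite !le_max lexx ?orbT.
have ua := h3 a M3a.
have [n hn] : exists n : nat, n.+1%:R^-1 < F d.+1 a.
  exists (Num.truncn (F d.+1 a)^-1); rewrite invf_plt ?posrE//.
  by rewrite truncnS_gt.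
have /nearyP[M4 h4] := top_derivative_le_inv n.
pose b := Num.max a (M4 + 1).
have ab : a <= b by rewrite le_max lexx.
have [c /andP[ac cb] Fe] := mvt_ray h2 M2a ab.
have : F d.+1 b <= n.+1%:R^-1 by apply: h4; rewrite lt_max ltrDl ltr01 orbT.
have : 0 <= F d.+1 b - F d.+1 a.
  rewrite Fe mulr_ge0 ?subr_ge0// ltW// h1//; exact: lt_le_trans ac.
move: hn; move: (F d.+1 b) (F d.+1 a) (n.+1%:R^-1) => p q s; lra.
Qed.

(** The identity function need not belong to the Hardy field, so the growth of
    x u(x), u being the derivative of order d + 1, is read off v = 1 / u. The
    sign of v' - 1 / m is eventually constant. If it is positive then v is at
    least x / (2 m), so u = O(1 / x), which is excluded; otherwise v grows at
    most like x / m, and x u is at least m / 2 in the limit. *)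
Lemma top_derivative_mulx_large n : \forall x \near +oo, n%:R <= x * F d.+1 x.
Proof.
have u0 : ~ (\forall x \near +oo, F d.+1 x = 0).
  move=> h; have [M hM] := (nearyP _).1 (filterI h top_derivative_gt0).
  have [] := hM (M + 1); first by rewrite ltrDl.
  by move=> ->; rewrite ltxx.
have [v Hv /nearyP[M1 uv]] := hardy_inv HH (HF d.+1) u0.
have /nearyP[M2 dv] := hardy_is_derive Hv.
have /nearyP[M3 u_gt0] := top_derivative_gt0.
pose m := (2 * n).+1; have m0 : 0 < m%:R :> R by [].
have key := hardy_sign (hardy_sub HH (hardy_derive HH Hv) (hardy_inv_nat (2 * n))).
have bound (a x : R) : Num.max M1 (Num.max M2 M3) < a -> a <= x ->
  exists2 c, a <= c <= x & v x = v a + derive1 v c * (x - a).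
  rewrite !gt_max => /and3P[M1a M2a M3a] ax.
  by have [c cax ve] := mvt_ray dv M2a ax; exists c => //; rewrite -ve addrC subrK.
have vE x : M1 < x -> M3 < x -> v x = (F d.+1 x)^-1.
  move=> M1x M3x; have := uv x M1x => uvx; have ux := u_gt0 x M3x.
  by apply: (mulfI (lt0r_neq0 ux)); rewrite uvx divff// lt0r_neq0.
case: key => /nearyP[M4 h4].
  exfalso; apply: (@top_derivative_not_le_inv (2 * m%:R)); apply/nearyP.
  pose a := Num.max (Num.max 0 M4) (Num.max M1 (Num.max M2 M3)) + 1.
  have Ma : Num.max (Num.max 0 M4) (Num.max M1 (Num.max M2 M3)) < a by rewrite ltrDl.
  move: Ma; rewrite [in X in X -> _]gt_max => /andP[]; rewrite gt_max => /andP[a0 M4a] Ma.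
  exists (2 * a) => x ax; have xa : a <= x by lra.
  have x0 : 0 < x by lra.
  have [c /andP[ac cx] vx] := bound a x Ma xa.
  have := Ma; rewrite !gt_max => /and3P[M1a M2a M3a].
  have M1x := lt_le_trans M1a xa; have M3x := lt_le_trans M3a xa.
  have va : 0 < v a by rewrite vE// invr_gt0 u_gt0.
  have := h4 c (lt_le_trans M4a ac); rewrite subr_gt0 -/m => hc.
  have h5 : m%:R^-1 * (x - a) <= derive1 v c * (x - a) by rewrite ler_wpM2r ?subr_ge0// ltW.
  have h6 : x / (2 * m%:R) <= v x.
    rewrite vx; apply: (@le_trans _ _ (m%:R^-1 * (x - a))); last by lra.
    have -> : x / (2 * m%:R) = m%:R^-1 * (x / 2) by rewrite invfM; ring.
    by rewrite ler_pM2l ?invr_gt0//; lra.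
  rewrite -[F d.+1 x]invrK -vE// -[2 * _ / x]invrK lef_pV2 ?posrE ?invr_gt0 ?divr_gt0 ?mulr_gt0//.
    by rewrite invf_div.
  by rewrite vE// invr_gt0 u_gt0.
apply/nearyP.
pose a := Num.max (Num.max 0 M4) (Num.max M1 (Num.max M2 M3)) + 1.
have Ma : Num.max (Num.max 0 M4) (Num.max M1 (Num.max M2 M3)) < a by rewrite ltrDl.
move: Ma; rewrite [in X in X -> _]gt_max => /andP[]; rewrite gt_max => /andP[a0 M4a] Ma.
have := Ma; rewrite !gt_max => /and3P[M1a M2a M3a].
exists (Num.max a (m%:R * v a)) => x; rewrite gt_max => /andP[/ltW xa xv].
have x0 : 0 < x by exact: lt_le_trans xa.
have [c /andP[ac cx] vx] := bound a x Ma xa.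
have M1x := lt_le_trans M1a xa; have M3x := lt_le_trans M3a xa.
have := h4 c (lt_le_trans M4a ac); rewrite subr_le0 -/m => hc.
have h5 : derive1 v c * (x - a) <= m%:R^-1 * x.
  apply: (@le_trans _ _ (m%:R^-1 * (x - a))); first by rewrite ler_wpM2r ?subr_ge0.
  by rewrite ler_wpM2l ?invr_ge0// gerBl ltW.
have h6 : v a <= m%:R^-1 * x by rewrite mulrC ler_pdivlMr// mulrC ltW.
have vx0 : 0 < v x by rewrite vE// invr_gt0 u_gt0.
have h7 : m%:R * v x <= 2 * x.
  have -> : 2 * x = m%:R * (m%:R^-1 * x + m%:R^-1 * x) by field; rewrite gt_eqF.
  by rewrite ler_pM2l// vx lerD.
rewrite -[F d.+1 x]invrK -vE// ler_pdivlMr//.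
have mn : (2 * n%:R) <= m%:R :> R by rewrite /m -natrM ler_nat.
have : 2 * n%:R * v x <= m%:R * v x by rewrite ler_wpM2r// ltW.
by move: h7; lra.
Qed.

(** Otherwise f would grow at most linearly. *)
Lemma first_derivative_ge1 : \forall x \near +oo, 1 <= F 1 x.
Proof.
have [h|h] := hardy_sign (hardy_sub HH (HF 1) (hardy_one HH)).
  by apply: filterS h => x; rewrite subr_gt0 => /ltW.
exfalso; have h1 : \forall x \near +oo, F 1 x <= 1 * (x ^+ 0 * ln x).
  have [M hM] := (nearyP _).1 h; apply/nearyP; exists (Num.max M (expR 1)) => x.
  rewrite gt_max => /andP[/hM Mx ex]; rewrite mul1r.
  by apply: le_trans (lnX_ge1 0 (ltW ex)); rewrite -subr_le0.
have [C C0 hC] := integrate_ln_bound (dF 0) h1.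
apply: (@not_le_xln C); have [M hM] := (nearyP _).1 hC.
apply/nearyP; exists (Num.max M (expR 1)) => x; rewrite gt_max => /andP[/hM Mx ex].
apply: (le_trans Mx); rewrite ler_wpM2l//.
have x1 : 1 <= x by apply: le_trans (ltW ex); exact: expR1_ge1.
by rewrite ler_wpM2r ?ln_ge0// ler_weXn2l.
Qed.

End growth.
End hardy.

(** * Shifts of a function in a Hardy field *)

Section discretization.
Variables (R : realType) (r : nat).
Implicit Types a : nat -> R.

Lemma act_X1 a n : act r ('X - 1) a n = a (n + r)%N - a n.
Proof. by rewrite actB act1 -['X]expr1 actXn muln1. Qed.

Lemma act_X1_exp (f : R -> R) d n :
  act r (('X - 1) ^+ d) (fun n => f n%:R) n = iterated_diff (nseq d r%:R) f n%:R.
Proof.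
elim: d n => [|d ih] n; first by rewrite expr0 act1.
by rewrite exprS actM act_X1 !ih /= natrD.
Qed.

Lemma iter_diff_act a i n l :
  iter i (@diff R) (fun j => a (n + r * j)%N) l = act r (('X - 1) ^+ i) a (n + r * l)%N.
Proof.
elim: i l => [|i ih] l; first by rewrite expr0 act1.
by rewrite /= /diff !ih exprS actM act_X1 mulnS addnCA addnC.
Qed.

(** By Newton's formula the error is a combination of the differences of order
    at least d + 1, which are obtained from the difference of g by the action
    of polynomials. *)
Lemma extrap_error_cvg0 d a j (g := act r (('X - 1) ^+ d) a) :
  g n.+1 - g n @[n --> \oo] --> 0 ->
  a (n + r * j)%N - extrap d (fun i => a (n + r * i)%N) j @[n --> \oo] --> 0.
Proof.
move=> dg0.
have top0 : act r (('X - 1) ^+ d.+1) a @ \oo --> 0.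
  have := act_near_horner r ('X - 1) dg0.
  rewrite !hornerE subrr; apply: cvg_trans; apply: near_eq_cvg; apply: nearW => n.
  by rewrite mul0r subr0 exprS actM.
have iter0 i : act r (('X - 1) ^+ (d.+1 + i)) a @ \oo --> 0.
  have := act_cvg0 r (('X - 1) ^+ i) top0.
  by apply: cvg_trans; apply: near_eq_cvg; apply: nearW => n; rewrite -actM -exprD addnC.
have : (\sum_(i < j) 'C(j, d.+1 + i)%:R * act r (('X - 1) ^+ (d.+1 + i)) a n) @[n --> \oo] --> 0.
  by apply: cvg0_sum => i; apply: cvg0Ml.
apply: cvg_trans; apply: near_eq_cvg; apply: nearW => n.
pose x i := a (n + r * i)%N; rewrite -/x -[a (n + r * j)%N]/(x (0 + j)%N).
rewrite (@newton_expansion _ x 0 (d.+1 + j)); last by rewrite addSn ltnS leq_addl.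
rewrite /extrap /newton_sum big_split_ord; apply: (canRL (addrK _)).
rewrite addrC; congr (_ + _); apply: eq_bigr => i _.
rewrite -[X in _ * act _ _ _ X]addn0 -[X in (n + X)%N](muln0 r).
by rewrite -iter_diff_act mulr_natl.
Qed.

End discretization.

Section equidistribution.
Variables (R : realType) (H : set (R -> R)).
Hypothesis HH : hardy_field H.
Variables (f : R -> R) (d r : nat).
Hypotheses (Hf : H f) (d_gt0 : (0 < d)%N) (r_gt0 : (0 < r)%N).
Hypothesis f_lower : asymp_lt (fun x : R => x ^+ d * ln x) f.
Hypothesis f_upper : asymp_lt f (fun x : R => x ^+ d.+1).

Let F i := derive1n i f.

Lemma near_pinfty_nat (P : R -> Prop) : (\forall x \near +oo, P x) ->
  \forall n \near \oo, forall x, n%:R <= x -> P x.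
Proof.
move=> /nearyP[M h]; near=> n => x nx; apply: h; apply: lt_le_trans nx.
by near: n; exact: nbhs_infty_gtr.
Unshelve. all: by end_near. Qed.

Lemma iterated_diff_mean_value hs : all (fun h => 0 <= h) hs ->
  \forall n \near \oo, exists2 c, n%:R <= c <= n%:R + \sum_(h <- hs) h &
    iterated_diff hs f n%:R = (\prod_(h <- hs) h) * F (size hs) c.
Proof.
move=> hs0.
have : \forall x \near +oo, forall i : 'I_(size hs), is_derive (x : R) 1 (F i) (F i.+1 x).
  apply: filter_forall => i; rewrite /F derive1nS.
  exact: (hardy_is_derive HH (hardy_derive1n HH i Hf)).
move=> /nearyP[M hM]; near=> n.
have Mn : M < n%:R by near: n; exact: nbhs_infty_gtr.
have [|c hc e] := @mvt_iterated_diff _ hs F M hs0 _ n%:R Mn; last by exists c.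
by move=> i x ih Mx; exact: (hM x Mx (Ordinal ih)).
Unshelve. all: by end_near. Qed.

(* The d-th difference of f with step r, whose increments are differences of
   order d + 1. *)
Let g := act r (('X - 1) ^+ d) (fun n => f n%:R).

Let g_diff n : g n.+1 - g n = iterated_diff (1 :: nseq d r%:R) f n%:R.
Proof. by rewrite /g !act_X1_exp /= natr1. Qed.

Let g_diff2 n : (g n.+2 - g n.+1) - (g n.+1 - g n) =
  iterated_diff (1 :: 1 :: nseq d r%:R) f n%:R.
Proof. by rewrite !g_diff /= !natr1. Qed.

Let r0 : 0 <= r%:R :> R. Proof. by []. Qed.

Let all_ge0 m : all (fun h : R => 0 <= h) (nseq m 1 ++ nseq d r%:R).
Proof. by rewrite all_cat !all_nseq ler01 r0 !orbT. Qed.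

Let rd_gt0 : 0 < r%:R ^+ d :> R. Proof. by rewrite exprn_gt0// ltr0n. Qed.

Lemma g_diff_value : \forall n \near \oo, exists2 c,
  n%:R <= c <= n%:R + (1 + r%:R *+ d) & g n.+1 - g n = r%:R ^+ d * F d.+1 c.
Proof.
have := iterated_diff_mean_value (all_ge0 1); apply: filterS => n [c cn e].
exists c; first by move: cn; rewrite /= big_cons big_nseq; rewrite iter_addr_0.
by rewrite g_diff e /= size_nseq big_cons mul1r big_nseq iter_mulr_1.
Qed.

Lemma g_diff_gt0 : \forall n \near \oo, 0 < g n.+1 - g n.
Proof.
have h := near_pinfty_nat (top_derivative_gt0 HH Hf f_lower).
near=> n.
have [c /andP[nc _] ->] : exists2 c,
  n%:R <= c <= n%:R + (1 + r%:R *+ d) & g n.+1 - g n = r%:R ^+ d * F d.+1 c.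
  by near: n; exact: g_diff_value.
rewrite mulr_gt0//; move: c nc; near: n; exact: h.
Unshelve. all: by end_near. Qed.

Lemma g_diff_cvg0 : g n.+1 - g n @[n --> \oo] --> 0.
Proof.
apply/cvgr0Pnorm_le => e e0.
have er : 0 < e / r%:R ^+ d by rewrite divr_gt0.
have [m me] : exists m : nat, m.+1%:R^-1 < e / r%:R ^+ d.
  exists (Num.truncn (e / r%:R ^+ d)^-1); rewrite invf_plt ?posrE//.
  by rewrite truncnS_gt.
have h := near_pinfty_nat (top_derivative_le_inv HH Hf f_upper m).
near=> n.
have [c /andP[nc _] ge] : exists2 c,
  n%:R <= c <= n%:R + (1 + r%:R *+ d) & g n.+1 - g n = r%:R ^+ d * F d.+1 c.
  by near: n; exact: g_diff_value.
rewrite gtr0_norm; last by near: n; exact: g_diff_gt0.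
rewrite ge mulrC -ler_pdivlMr//; apply: le_trans (ltW me).
move: c nc {ge}; near: n; exact: h.
Unshelve. all: by end_near. Qed.

Lemma g_diff_decr : \forall n \near \oo, g n.+2 - g n.+1 <= g n.+1 - g n.
Proof.
have h := near_pinfty_nat (top_derivative_decreasing HH Hf f_lower f_upper).
have hm := iterated_diff_mean_value (all_ge0 2).
near=> n.
have [c /andP[nc _]] : exists2 c,
    n%:R <= c <= n%:R + \sum_(h <- nseq 2 1 ++ nseq d r%:R) h &
    iterated_diff (nseq 2 1 ++ nseq d r%:R) f n%:R =
    \prod_(h <- nseq 2 1 ++ nseq d r%:R) h * F (size (nseq 2 (1 : R) ++ nseq d r%:R)) c.
  by near: n; exact: hm.
move=> e; rewrite -subr_le0 g_diff2.
rewrite -[X in X <= 0]/(iterated_diff (nseq 2 1 ++ nseq d r%:R) f n%:R) e.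
rewrite /= size_nseq !big_cons !mul1r big_nseq iter_mulr_1 mulr_ge0_le0 ?(ltW rd_gt0)//.
move: c nc {e}; near: n; exact: h.
Unshelve. all: by end_near. Qed.

Lemma g_diff_large : n%:R * (g n.+1 - g n) @[n --> \oo] --> +oo.
Proof.
apply/cvgryPge => B; pose m := (Num.truncn (2 * B)).+1.
have h := near_pinfty_nat (top_derivative_mulx_large HH Hf f_lower m).
near=> n.
have [c /andP[nc cn] ge] : exists2 c,
  n%:R <= c <= n%:R + (1 + r%:R *+ d) & g n.+1 - g n = r%:R ^+ d * F d.+1 c.
  by near: n; exact: g_diff_value.
have g0 : 0 < g n.+1 - g n by near: n; exact: g_diff_gt0.
have nB : 1 + r%:R *+ d <= n%:R :> R by near: n; exact: nbhs_infty_ger.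
have F0 : 0 < F d.+1 c by move: g0; rewrite ge pmulr_rgt0.
have mc : m%:R <= c * F d.+1 c by move: c nc {cn ge F0}; near: n; exact: h.
have Bm : 2 * B < m%:R by exact: truncnS_gt.
have c2 : c <= 2 * n%:R by lra.
have rd1 : 1 <= r%:R ^+ d :> R by rewrite exprn_ege1// ler1n.
have h1 : c * F d.+1 c <= 2 * n%:R * F d.+1 c by rewrite ler_wpM2r// ltW.
have h2 : n%:R * F d.+1 c <= n%:R * (g n.+1 - g n).
  by rewrite ge ler_wpM2l// ler_peMl// ltW.
by move: mc Bm h1 h2; lra.
Unshelve. all: by end_near. Qed.

Theorem hardy_weyl (h : 'I_d.+1 -> int) t : (exists i, h i != 0) ->
  has_mean (fun n => cos (2 * pi * (\sum_i (h i)%:~R * f (n + r * i)%N%:R) + t)) 0.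
Proof.
move=> [i0 hi0]; pose P : {poly int} := \poly_(i < d.+1) h (inord i).
have Ph (i : 'I_d.+1) : P`_i = h i by rewrite coef_poly ltn_ord inord_val.
have P0 : P != 0 by apply: contraNneq hi0 => P0; rewrite -Ph P0 coef0.
have sP : (size P <= d.+1)%N by exact: size_poly.
have := @polynomial_equidistribution _ r (fun n => f n%:R) d g_diff_gt0 g_diff_decr
  g_diff_cvg0 g_diff_large P P0 sP t.
apply: has_mean_ext => n; rewrite (act_widen _ _ _ sP).
by congr (cos (_ * _ + _)); apply: eq_bigr => i _; rewrite Ph.
Qed.

Lemma f_increasing : \forall n \near \oo, forall m m' : nat, (n <= m)%N -> (m < m')%N ->
  f m%:R + 1 <= f m'%:R.
Proof.
have /nearyP[M1 h1] := first_derivative_ge1 HH Hf d_gt0 f_lower.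
have /nearyP[M2 h2] := hardy_is_derive HH Hf.
near=> n => m m' nm mm'.
have M1n : M1 < n%:R by near: n; exact: nbhs_infty_gtr.
have M2n : M2 < n%:R by near: n; exact: nbhs_infty_gtr.
have nm' : n%:R <= m%:R :> R by rewrite ler_nat.
have mm1 : m%:R + 1 <= m'%:R :> R by rewrite natr1 ler_nat.
have [|c /andP[mc _] e] := mvt_ray h2 (lt_le_trans M2n nm') (_ : m%:R <= m'%:R).
  by lra.
rewrite -lerBrDl e; apply: (@le_trans _ _ (1 * (m'%:R - m%:R))); first by lra.
rewrite ler_wpM2r ?h1//; first by rewrite subr_ge0; lra.
exact: lt_le_trans M1n (le_trans nm' mc).
Unshelve. all: by end_near. Qed.

Lemma f_ge1 : \forall n \near \oo, forall m : nat, (n <= m)%N -> 1 <= f m%:R.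
Proof.
have /cvgryPge/(_ 1) hl := f_lower.
have := near_pinfty_nat hl; apply: filterS2 (nbhs_infty_ger (expR 1)) => n en h m nm.
have nm' : n%:R <= m%:R :> R by rewrite ler_nat.
have l1 := lnX_ge1 d (le_trans en nm').
have := h _ nm'; rewrite ler_pdivlMr ?(lt_le_trans ltr01 l1)// mul1r.
exact: le_trans.
Qed.

End equidistribution.

(** * Frequency of the polynomial patterns *)

(** The first two conditions concern positivity and growth only, so for a
    positive increasing sequence membership amounts to the vanishing of the
    differences of order d + 1. *)
Lemma PkdE (k d : nat) (a : nat -> int) : (d < k)%N ->
  (forall j, (j < k)%N -> 0 < a j) ->
  (forall m n, (m < n)%N -> (n < k)%N -> a m < a n) ->
  Pkd k d a = [forall j : 'I_k, a j == extrap d a j].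
Proof.
move=> dk a0 a_incr; rewrite /Pkd.
have -> : [forall n : 'I_k, 0 < a n] by apply/forallP => n; exact: a0.
have -> : [forall m : 'I_k, forall n : 'I_k, (m < n)%N ==> (a m < a n)].
  by apply/forallP => m; apply/forallP => n; apply/implyP => mn; exact: a_incr.
have [h1 h2] := constant_diffP a dk.
apply/idP/idP => /= [/forallP h|/forallP h].
  apply/forallP => j; apply/eqP/h1 => // m n mk nk.
  by have /forallP/(_ (Ordinal nk))/eqP := h (Ordinal mk).
apply/forallP => m; apply/forallP => n; apply/eqP; apply: h2 => // j jk.
exact/eqP/(h (Ordinal jk)).
Qed.

Lemma card_ord_sum (R : realType) (G : pred nat) N :
  #|[pred n : 'I_N.+1 | G n]|%:R = \sum_(n < N) (G n)%:R + (G N)%:R :> R.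
Proof.
rewrite -sum1_card natr_sum big_mkcond big_ord_recr /=.
by congr (_ + _); [apply: eq_bigr => n _|]; rewrite !inE /=; case: (G _).
Qed.

Lemma has_mean_card (R : realType) (G : pred nat) (V : R) :
  has_mean (fun n => (G n)%:R) V ->
  #|[pred n : 'I_N.+1 | G n]|%:R / N%:R @[N --> \oo] --> V.
Proof.
move=> hG; have h0 : (fun N : nat => (G N)%:R / N%:R : R) @ \oo --> (0 : R).
  have h : (fun N : nat => N%:R^-1 : R) @ \oo --> (0 : R).
    by rewrite -cvg_shiftS; exact: cvg_harmonic.
  apply: (squeeze_cvgr _ (cvg_cst 0) h); apply: nearW => N.
  by case: (G N); rewrite ?mul1r ?mul0r ?invr_ge0 ?lexx ?ler0n.
have h : (fun N : nat => (\sum_(n < N) (G n)%:R) / N%:R + (G N)%:R / N%:R) @ \oo --> V + 0.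
  exact: cvgD hG h0.
rewrite addr0 in h; apply: cvg_trans h; apply: near_eq_cvg; apply: nearW => N.
by rewrite card_ord_sum mulrDl.
Qed.

Unset Implicit Arguments.

Theorem theorem2p2 (R : realType) (n0 d : nat) (f f' : R -> R)
  (n0_gt0 : (0 < n0)%N) (d_gt0 : (0 < d)%N)
  (f_derive : forall x : R, n0%:R <= x ->
     is_derive_within `[n0%:R, +oo[ f x (f' x))
  (f_hardy : in_some_hardy_field f)
  (a1_lower : asymp_lt (fun x : R => x ^+ d * ln x) f)
  (a1_upper : asymp_lt f (fun x : R => x ^+ d.+1))
  (a2 : (1 <= ereal_inf [set (f' x)%:E | x in `[n0%:R, +oo[])%E) :
  (forall k r : nat, (d + 2 <= k)%N -> (1 <= r)%N ->
     (#|[pred n : 'I_N.+1 | (n0 <= n)%N &&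
          Pkd k d (fun j => Num.floor (f (n + r * j)%N%:R))]|%:R / N%:R)%:E
       @[N --> \oo] --> lebesgue_tuple (@Ckd R k d)) /\
  (forall k : nat, (d + 2 <= k)%N ->
     (((\prod_(1 <= i < d.+1) 'C((k - 1)%N, i)%:R)^-1)%:E
        <= lebesgue_tuple (@Ckd R k d))%E).
Proof.
split=> [k r dk r_gt0|k dk]; last exact: volume_ge.
have dk' : (d < k)%N by lia.
have [H HH Hf] := f_hardy.
have [V [-> card_le_volume volume_le_card]] := volume_lattice R dk'.
pose x n j : R := f (n + r * j)%N%:R.
pose G n := [forall j : 'I_k, Num.floor (x n j) == extrap d (fun i => Num.floor (x n i)) j].
have GP n : G n <-> forall j, (j < k)%N ->
    0 <= extrap d (fun i => x n i - (Num.floor (x n i))%:~R) j + (x n j - extrap d (x n) j) < 1.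
  rewrite -floor_extrapP; split => [/forallP h j jk|h].
    exact/eqP/(h (Ordinal jk)).
  by apply/forallP => j; apply/eqP; exact: h.
have err0 j : (j < k)%N -> x n j - extrap d (x n) j @[n --> \oo] --> 0.
  move=> _; apply: (@extrap_error_cvg0 _ r d (fun n => f n%:R)).
  exact: (g_diff_cvg0 HH Hf r_gt0 a1_lower a1_upper).
have weyl (h : 'I_d.+1 -> int) : (exists i, h i != 0) -> forall t,
    has_mean (fun n => cos (2 * pi * (\sum_i (h i)%:~R * x n i) + t)) 0.
  by move=> h0 t; exact: (hardy_weyl HH Hf r_gt0 a1_lower a1_upper).
have meanG := lattice_density dk' weyl err0 card_le_volume volume_le_card GP.
apply: cvg_EFin; first exact: nearW.
pose P n := (n0 <= n)%N && Pkd k d (fun j => Num.floor (f (n + r * j)%N%:R)).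
suff hP : has_mean (fun n => (P n)%:R : R) V by exact: (has_mean_card hP).
apply: has_mean_sub meanG; apply: cvg_near_cst.
have incr := f_increasing HH Hf d_gt0 a1_lower.
have pos := f_ge1 a1_lower.
near=> n.
have n0n : (n0 <= n)%N by near: n; exact: nbhs_infty_ge.
have incrn : forall m m' : nat, (n <= m)%N -> (m < m')%N -> f m%:R + 1 <= f m'%:R.
  by near: n.
have posn : forall m : nat, (n <= m)%N -> 1 <= f m%:R by near: n.
rewrite /P n0n /= PkdE ?subrr// => [j jk|i j ij jk].
  by rewrite gtz0_ge1 floor_ge_int /= posn// leq_addr.
rewrite -lezD1 floor_ge_int intrD1.
apply: le_trans (incrn (n + r * i)%N _ _ _).
- by rewrite lerD2r floor_le.
- exact: leq_addr.
- by rewrite ltn_add2l ltn_pmul2l.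
Unshelve. all: by end_near. Qed.
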